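(* Let $N\ge 1$, $1\le k\le N$, $x\in\mathbb{Z}$, $t\ge0$, $Y=(1,2,\dots,N)$, and let $C$ be a counterclockwise circle centered at the origin with radius in $(0,1)$. Then \[ \mathbb{P}_{(Y,\nu^{(k)})}(E_{t,k,x}) = \frac{(-1)^{N(N-1)/2}}{N!}\,\frac{1}{(2\pi i)^N}\oint_C\cdots\oint_C\prod_{1\leq i<j\leq N}(\xi_j-\xi_i)^2\prod_{i=1}^N\frac{1}{(\xi_i-1)^{N-1}}\prod_{i=1}^N \Big(\xi_i^{x-N-1}e^{\varepsilon(\xi_i) t}\Big)\,d\xi_1\cdots d\xi_N . \] In particular the right side does not depend on $k$.
   Context: TASEP with second class particles: $N$ particles occupy distinct sites of $\mathbb{Z}$; each particle carries a label $1$ or $2$ (label-$2$ particles are ''first class'', label-$1$ particles are ''second class''). Each particle independently, at rate $1$, attempts to jump to the neighboring site to its right: if that site is empty the jump occurs; if it is occupied by a particle of the same label the jump is suppressed; if a label-$2$ particle attempts to jump onto a site occupied by a label-$1$ particle, the two exchange positions; if a label-$1$ particle attempts to jump onto a site occupied by a label-$2$ particle, the jump is suppressed. A state is a pair $(X,\pi)$ with $X=(x_1<\dots<x_N)\in\mathbb{Z}^N$ and $\pi\in\{1,2\}^N$, meaning the $i$-th particle from the left is at $x_i$ and has label $\pi_i$. For $1\le k\le N$, $\nu^{(k)}$ is the sequence with first $k$ entries $2$ and remaining $N-k$ entries $1$. $E_{t,k,x}$ is the event that at time $t$ the state is $(X,\nu^{(k)})$ for some $X$ with $x_1=x,x_2=x+1,\dots,x_k=x+k-1$.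 $\mathbb{P}_{(Y,\nu)}$ is the law of the process started from state $(Y,\nu)$. $\varepsilon(\xi)=1/\xi-1$. *)

(* Defs.v *)
From Stdlib Require Import Reals ZArith Arith List Bool.
Import ListNotations.
Open Scope R_scope.

(* A state (X, pi): X = positions x_1<...<x_N (list of length N),
   pi = labels (list of length N, entries 1 or 2). *)
Definition state := (list Z * list nat)%type.

Fixpoint set_nth {A : Type} (l : list A) (i : nat) (a : A) : list A :=
  match l, i with
  | [], _ => []
  | _ :: t, O => a :: t
  | h :: t, S j => h :: set_nth t j a
  end.

(* Effect of the clock of the (i+1)-th particle from the left (0-indexed i)
   ringing: it attempts to jump to x_i + 1. *)
Definition step (N : nat) (s : state) (i : nat) : state :=
  let (X, p) := s in
  let xi := nth i X 0%Z in
  if (S i <? N)%nat && Z.eqb (nth (S i) X 0%Z) (xi + 1)%Z then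
    if (Nat.eqb (nth i p 0%nat) 2) && (Nat.eqb (nth (S i) p 0%nat) 1)
    then (X, set_nth (set_nth p i 1%nat) (S i) 2%nat)
    else s
  else (set_nth X i (xi + 1)%Z, p).

Fixpoint cnt (N : nat) (E : state -> bool) (n : nat) (s : state) : nat :=
  match n with
  | O => if E s then 1%nat else 0%nat
  | S m => list_sum (map (fun i => cnt N E m (step N s i)) (seq 0 N))
  end.

(* Law of the continuous-time process (independent rate-1 clocks, i.e. a
   Poisson(N t) number of rings, each at a uniformly chosen particle):
   P_s(state at time t in E) = sum_n e^{-N t} t^n / n! * cnt n s. *)
Definition tasep_prob_is (N : nat) (s : state) (E : state -> bool) (t P : R) : Prop :=
  infinite_sum
    (fun n => exp (- (INR N * t)) * t ^ n / INR (fact n) * INR (cnt N E n s)) P.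

Definition nu (N k : nat) : list nat := repeat 2%nat k ++ repeat 1%nat (N - k).

Definition Yinit (N : nat) : list Z := map (fun i => Z.of_nat (S i)) (seq 0 N).

Definition Eevent (N k : nat) (x : Z) (s : state) : bool :=
  let (X, p) := s in
  (if list_eq_dec Nat.eq_dec p (nu N k) then true else false) &&
  forallb (fun j => Z.eqb (nth j X 0%Z) (x + Z.of_nat j)%Z) (seq 0 k).

Definition Cx := (R * R)%type.
Definition Cre (z : Cx) : R := fst z.
Definition Cim (z : Cx) : R := snd z.
Definition Cof (a : R) : Cx := (a, 0).
Definition Cadd (z w : Cx) : Cx := (fst z + fst w, snd z + snd w).
Definition Csub (z w : Cx) : Cx := (fst z - fst w, snd z - snd w).
Definition Cmul (z w : Cx) : Cx :=
  (fst z * fst w - snd z * snd w, fst z * snd w + snd z * fst w).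
Definition Cinv (z : Cx) : Cx :=
  let d := fst z * fst z + snd z * snd z in (fst z / d, - snd z / d).
Definition Cexp (z : Cx) : Cx := (exp (fst z) * cos (snd z), exp (fst z) * sin (snd z)).
Definition Ci : Cx := (0, 1).
Fixpoint Cpow (z : Cx) (n : nat) : Cx :=
  match n with O => Cof 1 | S m => Cmul z (Cpow z m) end.
Definition CpowZ (z : Cx) (m : Z) : Cx :=
  match m with
  | Z0 => Cof 1
  | Zpos p => Cpow z (Pos.to_nat p)
  | Zneg p => Cinv (Cpow z (Pos.to_nat p))
  end.
Definition Cprod (l : list Cx) : Cx := fold_right Cmul (Cof 1) l.

Definition Ceps (z : Cx) : Cx := Csub (Cinv z) (Cof 1).

Definition RI02pi (h : R -> R) (v : R) : Prop :=
  exists pr : Riemann_integrable h 0 (2 * PI), RiemannInt pr = v.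

Inductive IterInt : nat -> (list R -> Cx) -> Cx -> Prop :=
| IterInt0 (f : list R -> Cx) : IterInt 0 f (f nil)
| IterIntS (n : nat) (f : list R -> Cx) (g : R -> Cx) (v : Cx) :
    (forall th : R, IterInt n (fun l => f (th :: l)) (g th)) ->
    RI02pi (fun th => fst (g th)) (fst v) ->
    RI02pi (fun th => snd (g th)) (snd v) ->
    IterInt (S n) f v.

Definition circ (r th : R) : Cx := (r * cos th, r * sin th).

(* The contour integrand after the parametrization xi_j = r e^{i theta_j},
   d xi_j = i xi_j d theta_j, for j = 1..N. *)
Definition integrand (N : nat) (x : Z) (t r : R) (ths : list R) : Cx :=
  let xi := fun j => circ r (nth j ths 0) in
  Cmul
   (Cprod (flat_map (fun j => map (fun i => Cpow (Csub (xi j) (xi i)) 2) (seq 0 j))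
                    (seq 0 N)))
   (Cprod (map (fun i =>
      Cmul (Cinv (Cpow (Csub (xi i) (Cof 1)) (N - 1)))
      (Cmul (CpowZ (xi i) (x - Z.of_nat N - 1)%Z)
      (Cmul (Cexp (Cmul (Ceps (xi i)) (Cof t)))
            (Cmul Ci (xi i)))))                    (* Jacobian d xi / d theta *)
     (seq 0 N))).

Definition prefactor (N : nat) : Cx :=
  Cmul (Cof ((-1) ^ (N * (N - 1) / 2) / INR (fact N)))
       (Cinv (Cpow (0, 2 * PI) N)).

(* Main.v *)
(** Up to time [t] the label word stays [nu N k] unless particle [k] attempts to
    jump onto particle [k+1], after which it never returns; so one studies the
    process killed at that moment.  Its generator is the free generator
    [A = sum_i T_i], [T_i] moving particle [i] by one, with a boundary condition
    on [Y_(j+1) = Y_j + 1]: [T_j F = F] if [j <> k] and [T_j F = 0] if [j = k].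
    A determinant whose row [j] depends on [Y_j] only satisfies these conditions
    as soon as row [j+1] is the backward difference of row [j] ([j <> k]), resp.
    the same function ([j = k]), and both persist under [A] because they express
    antisymmetry of a function of [(Y_j, Y_(j+1))].  Taking for the [(j,i)] entry
    the coefficient of [w^(Y_j - x - i)] in [(1 - w)^(e_j - i)], with [e_j = j]
    for [j < k] and [e_j = j - 1] for [j >= k], counted from [0], the determinant
    is the indicator of the event at [t = 0].

    Evolving in time replaces each entry by an exponential generating function.
    At [Y = (1..N)] every entry is an iterated difference of the same function,
    and two unitriangular changes of basis (one of them reversed, whence the
    sign) give a Hankel determinant that does not depend on [k].  Its entries
    are contour integrals, and expanding the two Vandermonde determinants in the
    integrand gives [N!] times the same Hankel determinant. *)

Require Import Defs.
From Stdlib Require Import Reals ZArith Arith List Lia Lra FunctionalExtensionality.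
From HB Require structures.
From mathcomp Require all_boot all_order all_algebra all_fingroup.
From mathcomp Require Rstruct ring zify.
From Coquelicot Require Coquelicot.
Open Scope R_scope.

(** * Exponential generating functions of differences *)

Module Egf.
Import Coquelicot.Coquelicot.

Definition bdiff (f : Z -> R) (n : Z) : R := f n - f (n - 1)%Z.

(* The coefficient of [z^n] in [(1 - z)^(-q)]. *)
Fixpoint negbin (q : nat) (n : Z) : R :=
  match q with
  | O => if Z.eqb n 0 then 1 else 0
  | S q' => if Z.ltb n 0 then 0
            else sum_f_R0 (fun j => negbin q' (Z.of_nat j)) (Z.to_nat n)
  end.

Lemma negbin_neg q n : (n < 0)%Z -> negbin q n = 0.
Proof.
intros Hn; destruct q as [|q]; simpl.
- destruct (Z.eqb_spec n 0); [lia|reflexivity].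
- destruct (Z.ltb_spec n 0); [reflexivity|lia].
Qed.

Lemma bdiff_negbin q n : bdiff (negbin (S q)) n = negbin q n.
Proof.
unfold bdiff; simpl.
destruct (Z.ltb_spec n 0).
- rewrite (negbin_neg q n) by assumption.
  destruct (Z.ltb_spec (n - 1) 0); [ring|lia].
- destruct (Z.ltb_spec (n - 1) 0).
  + replace n with 0%Z by lia; simpl; ring.
  + replace (Z.to_nat n) with (S (Z.to_nat (n - 1))) by lia.
    rewrite tech5.
    replace (Z.of_nat (S (Z.to_nat (n - 1)))) with n by lia.
    ring.
Qed.

Lemma iter_bdiff_negbin q p n :
  Nat.iter p bdiff (negbin (p + q)) n = negbin q n.
Proof.
revert q n; induction p as [|p IH]; intros q n; [reflexivity|].
replace (S p + q)%nat with (p + S q)%nat by lia; simpl.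
rewrite <- bdiff_negbin; unfold bdiff.
now rewrite !IH.
Qed.

Lemma iter_bdiff_neg p q n : (n < 0)%Z -> Nat.iter p bdiff (negbin q) n = 0.
Proof.
revert n; induction p as [|p IH]; intros n Hn; simpl.
- now apply negbin_neg.
- unfold bdiff; rewrite !IH by lia; ring.
Qed.

(** The differenced sequence has generating function $(1-z)^p$, a polynomial of degree [p]. *)
Lemma iter_bdiff_far p q n :
  (Z.of_nat p < n)%Z -> Nat.iter (p + q) bdiff (negbin q) n = 0.
Proof.
revert n; induction p as [|p IH]; intros n Hn; cbn [Nat.add].
- pose proof (iter_bdiff_negbin 0 q n) as H.
  rewrite Nat.add_0_r in H; rewrite H; simpl.
  destruct (Z.eqb_spec n 0); [lia|reflexivity].
- simpl; unfold bdiff; rewrite !IH by lia; ring.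
Qed.

(** Base 2 is an arbitrary choice above 1: summing from [0] to [n], shifting and differencing change
    only the constant [C], and the bound makes [egf] converge absolutely for every [t]. *)
Definition exp_growth (f : Z -> R) : Prop :=
  exists C, forall n, Rabs (f n) <= C * 2 ^ Z.abs_nat n.

Lemma exp_growth_bdiff f : exp_growth f -> exp_growth (bdiff f).
Proof.
intros [C HC]; exists (3 * C); intros n.
assert (HC0 : 0 <= C).
{ specialize (HC 0%Z); simpl in HC; pose proof (Rabs_pos (f 0%Z)); lra. }
unfold bdiff.
eapply Rle_trans; [apply Rabs_triang|rewrite Rabs_Ropp].
assert (H : 2 ^ Z.abs_nat (n - 1) <= 2 * 2 ^ Z.abs_nat n).
{ change (2 * 2 ^ Z.abs_nat n) with (2 ^ S (Z.abs_nat n)).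
  apply Rle_pow; [lra|lia]. }
pose proof (HC n); pose proof (HC (n - 1)%Z); nra.
Qed.

Lemma exp_growth_iter p f : exp_growth f -> exp_growth (Nat.iter p bdiff f).
Proof.
intros H; induction p; simpl; [assumption|now apply exp_growth_bdiff].
Qed.

Lemma exp_growth_shift f c : exp_growth f -> exp_growth (fun n => f (n - c)%Z).
Proof.
intros [C HC]; exists (C * 2 ^ Z.abs_nat c); intros n.
assert (HC0 : 0 <= C).
{ specialize (HC 0%Z); simpl in HC; pose proof (Rabs_pos (f 0%Z)); lra. }
eapply Rle_trans; [apply HC|].
rewrite Rmult_assoc; apply Rmult_le_compat_l; [assumption|].
rewrite <- pow_add; apply Rle_pow; [lra|lia].
Qed.

Lemma exp_growth_negbin q : exp_growth (negbin q).
Proof.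
induction q as [|q [C HC]].
- exists 1; intros n; simpl.
  assert (1 <= 2 ^ Z.abs_nat n) by (apply pow_R1_Rle; lra).
  destruct (Z.eqb n 0); [rewrite Rabs_R1|rewrite Rabs_R0]; lra.
- assert (HC0 : 0 <= C).
  { specialize (HC 0%Z); simpl in HC; pose proof (Rabs_pos (negbin q 0%Z)); lra. }
  exists (2 * C); intros n; simpl.
  assert (1 <= 2 ^ Z.abs_nat n) by (apply pow_R1_Rle; lra).
  destruct (Z.ltb_spec n 0); [rewrite Rabs_R0; nra|].
  replace (Z.abs_nat n) with (Z.to_nat n) by lia.
  generalize (Z.to_nat n); intros m.
  assert (Hs : Rabs (sum_f_R0 (fun j => negbin q (Z.of_nat j)) m)
               <= C * (2 * 2 ^ m - 1)).
  { induction m as [|m IH]; simpl sum_f_R0.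
    - specialize (HC 0%Z); simpl in *; lra.
    - eapply Rle_trans; [apply Rabs_triang|].
      specialize (HC (Z.of_nat (S m))).
      replace (Z.abs_nat (Z.of_nat (S m))) with (S m) in HC by lia.
      simpl in *; lra. }
  lra.
Qed.

Definition egf_term (f : Z -> R) (z : Z) (t : R) (n : nat) : R :=
  t ^ n / INR (fact n) * f (z + Z.of_nat n)%Z.

(** This is $e^{tS} f$ at [z], where $S$ is the shift by one: the semigroup of a single particle
    jumping to the right at rate 1, without its factor $e^{-t}$. *)
Definition egf (f : Z -> R) (z : Z) (t : R) : R := Series (egf_term f z t).

Lemma egf_abs f z t :
  exp_growth f -> ex_series (fun n => Rabs (egf_term f z t n)).
Proof.
intros [C HC].
assert (HC0 : 0 <= C).
{ specialize (HC 0%Z); simpl in HC; pose proof (Rabs_pos (f 0%Z)); lra. }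
apply @ex_series_le with
  (b := fun n => C * 2 ^ Z.abs_nat z * (/ INR (fact n) * (2 * Rabs t) ^ n)).
- intros n; change (norm (Rabs (egf_term f z t n)))
    with (Rabs (Rabs (egf_term f z t n))).
  rewrite Rabs_Rabsolu; unfold egf_term, Rdiv.
  rewrite !Rabs_mult, <- RPow_abs.
  rewrite (Rabs_pos_eq (/ INR (fact n)))
    by (left; apply Rinv_0_lt_compat, INR_fact_lt_0).
  rewrite Rpow_mult_distr.
  assert (H : Rabs (f (z + Z.of_nat n)%Z) <= C * (2 ^ Z.abs_nat z * 2 ^ n)).
  { eapply Rle_trans; [apply HC|].
    apply Rmult_le_compat_l; [assumption|].
    rewrite <- pow_add; apply Rle_pow; [lra|lia]. }
  assert (H0 : 0 <= Rabs t ^ n * / INR (fact n)).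
  { apply Rmult_le_pos; [apply pow_le, Rabs_pos|].
    left; apply Rinv_0_lt_compat, INR_fact_lt_0. }
  eapply Rle_trans; [apply Rmult_le_compat_l; [exact H0|exact H]|].
  right; ring.
- apply (ex_series_scal_l (K := R_AbsRing) (V := R_NormedModule)).
  apply ex_pseries_R.
  exists (exp (2 * Rabs t)); apply is_exp_Reals.
Qed.

Lemma egf_is_series f z t :
  exp_growth f -> is_series (egf_term f z t) (egf f z t).
Proof.
intros H; apply Series_correct, ex_series_Rabs, egf_abs, H.
Qed.

Lemma egf_bdiff f z t :
  exp_growth f -> egf (bdiff f) z t = egf f z t - egf f (z - 1) t.
Proof.
intros H; apply is_series_unique.
apply is_series_ext with
  (fun n => minus (egf_term f z t n) (egf_term f (z - 1) t n)).
- intros n; unfold egf_term, bdiff, minus, plus, opp; simpl.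
  replace (z - 1 + Z.of_nat n)%Z with (z + Z.of_nat n - 1)%Z by lia; ring.
- apply (is_series_minus (K := R_AbsRing) (V := R_NormedModule));
    now apply egf_is_series.
Qed.

Lemma egf_iter_bdiff p f z t : exp_growth f ->
  egf (Nat.iter p bdiff f) z t = Nat.iter p bdiff (fun z => egf f z t) z.
Proof.
intros H; revert z; induction p as [|p IH]; intros z; [reflexivity|].
simpl; rewrite egf_bdiff by now apply exp_growth_iter.
unfold bdiff at 2; now rewrite !IH.
Qed.

Lemma egf_shift f c z t : egf (fun n => f (n - c)%Z) z t = egf f (z - c) t.
Proof.
apply Series_ext; intros n; unfold egf_term.
now replace (z + Z.of_nat n - c)%Z with (z - c + Z.of_nat n)%Z by lia.
Qed.

(** Absolute convergence accompanies the value because it justifies the Cauchy product in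
    [abs_sum_conv] and is inherited by that product. *)
Definition abs_sum (a : nat -> R) (v : R) : Prop :=
  is_series a v /\ ex_series (fun n => Rabs (a n)).

Lemma abs_sum_infinite_sum a v : abs_sum a v -> infinite_sum a v.
Proof. intros [H _]; now apply is_series_Reals. Qed.

Lemma infinite_sum_ext a b v :
  (forall n, a n = b n) -> infinite_sum a v -> infinite_sum b v.
Proof.
intros Hab H; apply is_series_Reals, is_series_ext with a; [exact Hab|].
now apply is_series_Reals.
Qed.

Lemma abs_sum_ext a b v : (forall n, a n = b n) -> abs_sum a v -> abs_sum b v.
Proof.
intros Hab [H H']; split.
- now apply is_series_ext with a.
- apply ex_series_ext with (fun n => Rabs (a n)); [intros n; now rewrite Hab|].
  exact H'.
Qed.

Lemma abs_sum_egf f z t : exp_growth f -> abs_sum (egf_term f z t) (egf f z t).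
Proof. intros H; split; [now apply egf_is_series|now apply egf_abs]. Qed.

Lemma abs_sum_head (a : nat -> R) :
  (forall n, a (S n) = 0) -> abs_sum a (a 0%nat).
Proof.
assert (H : forall a : nat -> R, (forall n, a (S n) = 0) -> is_series a (a 0%nat)).
{ clear a; intros a Ha; apply is_series_Reals; intros eps Heps.
  exists 0%nat; intros n _.
  replace (sum_f_R0 a n) with (a 0%nat).
  - unfold Rdist; rewrite Rminus_diag_eq, Rabs_R0; trivial.
  - induction n as [|n IH]; [reflexivity|rewrite tech5, <- IH, Ha; ring]. }
intros Ha; split; [now apply H|].
eexists; apply (H (fun n => Rabs (a n))).
intros n; now rewrite Ha, Rabs_R0.
Qed.

Lemma abs_sum_add a b u v : abs_sum a u -> abs_sum b v ->
  abs_sum (fun n => a n + b n) (u + v).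
Proof.
intros [Ha Ha'] [Hb Hb']; split; [exact (is_series_plus _ _ _ _ Ha Hb)|].
apply @ex_series_le with (b := fun n => Rabs (a n) + Rabs (b n)).
- intros n; change (norm (Rabs (a n + b n))) with (Rabs (Rabs (a n + b n))).
  rewrite Rabs_Rabsolu; apply Rabs_triang.
- exact (ex_series_plus _ _ Ha' Hb').
Qed.

Lemma abs_sum_scal c a u : abs_sum a u -> abs_sum (fun n => c * a n) (c * u).
Proof.
intros [Ha Ha']; split; [exact (is_series_scal c _ _ Ha)|].
apply ex_series_ext with (fun n => Rabs c * Rabs (a n)).
- intros n; now rewrite Rabs_mult.
- exact (ex_series_scal (Rabs c) _ Ha').
Qed.

Definition conv (a b : nat -> R) (n : nat) : R :=
  sum_f_R0 (fun k => a k * b (n - k)%nat) n.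

Lemma abs_sum_conv a b u v : abs_sum a u -> abs_sum b v ->
  abs_sum (conv a b) (u * v).
Proof.
intros [Ha Ha'] [Hb Hb']; split; [now apply is_series_mult|].
apply @ex_series_le with
  (b := conv (fun n => Rabs (a n)) (fun n => Rabs (b n))).
- intros n; change (norm (Rabs (conv a b n))) with (Rabs (Rabs (conv a b n))).
  rewrite Rabs_Rabsolu; unfold conv.
  eapply Rle_trans; [apply Rsum_abs|].
  right; apply sum_eq; intros i _; apply Rabs_mult.
- destruct Ha' as [sa Hsa], Hb' as [sb Hsb]; exists (sa * sb).
  apply is_series_mult; trivial; eapply ex_series_ext;
    try (intros n; symmetry; apply Rabs_Rabsolu); eexists; eassumption.
Qed.

End Egf.

(** * Contour integrals on a circle *)

Module Contour.
Import Coquelicot.Coquelicot Egf.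

Definition is_CInt (f : R -> C) (v : C) : Prop :=
  is_RInt (fun th => fst (f th)) 0 (2 * PI) (fst v) /\
  is_RInt (fun th => snd (f th)) 0 (2 * PI) (snd v).

Lemma is_CInt_ext f g v :
  (forall th, f th = g th) -> is_CInt f v -> is_CInt g v.
Proof.
intros H [H1 H2]; split; eapply is_RInt_ext; try eassumption;
  intros; simpl; now rewrite H.
Qed.

Lemma is_CInt_unique f v w : is_CInt f v -> is_CInt f w -> v = w.
Proof.
intros [H1 H2] [H3 H4]; apply injective_projections.
- rewrite <- (is_RInt_unique _ _ _ _ H1); exact (is_RInt_unique _ _ _ _ H3).
- rewrite <- (is_RInt_unique _ _ _ _ H2); exact (is_RInt_unique _ _ _ _ H4).
Qed.

Lemma is_CInt_plus f g v w : is_CInt f v -> is_CInt g w ->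
  is_CInt (fun th => Cplus (f th) (g th)) (Cplus v w).
Proof.
intros [H1 H2] [H3 H4]; split.
- exact (is_RInt_plus _ _ _ _ _ _ H1 H3).
- exact (is_RInt_plus _ _ _ _ _ _ H2 H4).
Qed.

Lemma is_CInt_scal c f v : is_CInt f v ->
  is_CInt (fun th => Cmult c (f th)) (Cmult c v).
Proof.
intros [H1 H2]; split.
- exact (is_RInt_minus _ _ _ _ _ _
    (is_RInt_scal _ _ _ (fst c) _ H1) (is_RInt_scal _ _ _ (snd c) _ H2)).
- exact (is_RInt_plus _ _ _ _ _ _
    (is_RInt_scal _ _ _ (fst c) _ H2) (is_RInt_scal _ _ _ (snd c) _ H1)).
Qed.

Lemma is_RInt_eq (f : R -> R) a b (u v : R) :
  u = v -> is_RInt f a b u -> is_RInt f a b v.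
Proof. now intros ->. Qed.

Lemma RInt_bound f v M : is_RInt f 0 (2 * PI) v ->
  (forall th, Rabs (f th) <= M) -> Rabs v <= 2 * PI * M.
Proof.
intros H HM; pose proof PI_RGT_0.
rewrite <- (is_RInt_unique _ _ _ _ H).
replace (2 * PI * M) with ((2 * PI - 0) * M) by ring.
apply abs_RInt_le_const; [lra|now exists v|now intros].
Qed.

Definition ccont (f : R -> C) : Prop := forall th,
  continuous (fun th => fst (f th)) th /\ continuous (fun th => snd (f th)) th.

Lemma ccont_mult f g : ccont f -> ccont g -> ccont (fun th => Cmult (f th) (g th)).
Proof.
intros Hf Hg th; destruct (Hf th) as [H1 H2], (Hg th) as [H3 H4]; split.
- exact (continuous_minus _ _ _
    (continuous_mult (K := R_AbsRing) _ _ _ H1 H3)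
    (continuous_mult (K := R_AbsRing) _ _ _ H2 H4)).
- exact (continuous_plus _ _ _
    (continuous_mult (K := R_AbsRing) _ _ _ H1 H4)
    (continuous_mult (K := R_AbsRing) _ _ _ H2 H3)).
Qed.

Lemma ccont_const c : ccont (fun _ => c).
Proof. intros th; split; apply continuous_const. Qed.

Lemma ccont_pow f n : ccont f -> ccont (fun th => Cpow (f th) n).
Proof.
intros Hf; induction n; simpl; [apply ccont_const|now apply ccont_mult].
Qed.

Lemma is_CInt_ccont f : ccont f -> exists v, is_CInt f v.
Proof.
intros Hf.
destruct (ex_RInt_continuous (fun th => fst (f th)) 0 (2 * PI)) as [a Ha];
  [intros; apply Hf|].
destruct (ex_RInt_continuous (fun th => snd (f th)) 0 (2 * PI)) as [b Hb];
  [intros; apply Hf|].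
now exists (a, b).
Qed.

Lemma ccont_exp f : ccont f -> ccont (fun th => Cexp (f th)).
Proof.
intros Hf th; destruct (Hf th) as [H1 H2].
assert (He := continuous_comp _ _ _ H1 (continuous_exp _)).
split; simpl; apply (continuous_mult (K := R_AbsRing)); try exact He;
  apply (continuous_comp (fun th => snd (f th))); try assumption.
- apply continuous_cos.
- apply continuous_sin.
Qed.

(* [xi^p] for [xi = circ r th]. *)
Definition circpow (r : R) (p : Z) (th : R) : C :=
  (powerRZ r p * cos (IZR p * th), powerRZ r p * sin (IZR p * th)).

Lemma circpow_add r p q th : r <> 0 ->
  circpow r (p + q) th = Cmult (circpow r p th) (circpow r q th).
Proof.
intros Hr; unfold circpow; rewrite powerRZ_add, plus_IZR by assumption.
rewrite Rmult_plus_distr_r, cos_plus, sin_plus.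
apply injective_projections; simpl; ring.
Qed.

Lemma circpow_0 r th : circpow r 0 th = 1.
Proof.
unfold circpow; simpl; rewrite Rmult_0_l, cos_0, sin_0.
apply injective_projections; simpl; ring.
Qed.

Lemma circpow_1 r th : circpow r 1 th = circ r th.
Proof.
unfold circpow, circ; now rewrite powerRZ_1, !Rmult_1_l.
Qed.

Lemma circpow_nat r n th : r <> 0 -> circpow r (Z.of_nat n) th = Cpow (circ r th) n.
Proof.
intros Hr; induction n as [|n IH]; [apply circpow_0|].
rewrite Nat2Z.inj_succ, <- Z.add_1_l, circpow_add, IH, circpow_1; trivial.
Qed.

Lemma circpow_pow r p n th : r <> 0 ->
  Cpow (circpow r p th) n = circpow r (Z.of_nat n * p) th.
Proof.
intros Hr; induction n as [|n IH]; [now rewrite circpow_0|].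
replace (Z.of_nat (S n) * p)%Z with (p + Z.of_nat n * p)%Z by lia.
rewrite circpow_add, <- IH; trivial.
Qed.

Lemma Cmod_circpow r p th : 0 < r -> Cmod (circpow r p th) = powerRZ r p.
Proof.
intros Hr; unfold Cmod, circpow; simpl fst; simpl snd.
pose proof (sin2_cos2 (IZR p * th)) as H; unfold Rsqr in H.
replace (_ + _) with (powerRZ r p * powerRZ r p).
- now apply sqrt_square, powerRZ_le.
- transitivity (powerRZ r p * powerRZ r p *
    (sin (IZR p * th) * sin (IZR p * th) + cos (IZR p * th) * cos (IZR p * th)));
    [rewrite H|]; ring.
Qed.

Lemma ccont_circpow r p : ccont (circpow r p).
Proof.
intros th; split; apply @ex_derive_continuous; simpl; now auto_derive.
Qed.

Lemma Cmod_one_minus_circ r th : 0 < r -> 1 - r <= Cmod (1 - circ r th).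
Proof.
intros Hr.
assert (H : Cmod (1 - circ r th + circ r th) <= Cmod (1 - circ r th) + r).
{ eapply Rle_trans; [apply Cmod_triangle|].
  apply Rplus_le_compat_l; rewrite <- circpow_1, Cmod_circpow, powerRZ_1; lra. }
replace (1 - circ r th + circ r th)%C with (RtoC 1) in H by ring.
rewrite Cmod_1 in H; lra.
Qed.

Lemma one_minus_circ_neq0 r th : 0 < r < 1 -> (1 - circ r th)%C <> 0.
Proof.
intros Hr; apply Cmod_gt_0; pose proof (Cmod_one_minus_circ r th); lra.
Qed.

Definition geom (r th : R) : C := Cinv (1 - circ r th).

Lemma ccont_geom r : 0 < r < 1 -> ccont (geom r).
Proof.
intros Hr th.
assert (Hn : (1 - r * cos th) ^ 2 + (0 - r * sin th) ^ 2 <> 0).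
{ pose proof (one_minus_circ_neq0 r th Hr) as H; intros H0; apply H.
  assert (Hsq : (1 - r * cos th)² + (0 - r * sin th)² = 0)
    by (etransitivity; [|exact H0]; unfold Rsqr; ring).
  apply injective_projections; simpl.
  - apply Rplus_sqr_eq_0 in Hsq; lra.
  - apply Rplus_sqr_eq_0 in Hsq; lra. }
split; apply @ex_derive_continuous; simpl; unfold Rminus in *;
  auto_derive; simpl in *; intuition.
Qed.

Lemma Cmod_geom r th : 0 < r < 1 -> Cmod (geom r th) <= / (1 - r).
Proof.
intros Hr; unfold geom; rewrite Cmod_inv by now apply one_minus_circ_neq0.
apply Rinv_le_contravar; [lra|apply Cmod_one_minus_circ; lra].
Qed.

(** Orthogonality of characters: for [p <> 0] the integrand has a periodic primitive. The indicator
    of [p = 0] is written [negbin 0 (- p)] so as to start the induction on [q] in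
    [is_CInt_circpow_geom]. *)
Lemma is_CInt_circpow r p :
  is_CInt (circpow r p) (RtoC (2 * PI * negbin 0 (- p))).
Proof.
simpl; destruct (Z.eqb_spec (- p) 0) as [Hp|Hp].
- replace p with 0%Z by lia.
  apply is_CInt_ext with (fun _ => RtoC 1); [intros; now rewrite circpow_0|].
  split; simpl; eapply is_RInt_eq;
    try apply (is_RInt_const (V := R_NormedModule));
    unfold scal; simpl; unfold mult; simpl; ring.
- assert (Hp' : IZR p <> 0) by (apply eq_IZR_contrapositive; lia).
  assert (Hsin : sin (IZR p * (2 * PI)) = 0).
  { apply sin_eq_0_1; exists (2 * p)%Z; rewrite mult_IZR; ring. }
  assert (Hcos : cos (IZR p * (2 * PI)) = 1).
  { replace (IZR p * (2 * PI)) with (2 * (IZR p * PI)) by ring.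
    rewrite cos_2a_sin.
    replace (sin (IZR p * PI)) with 0; [ring|].
    symmetry; apply sin_eq_0_1; now exists p. }
  split; simpl.
  + eapply is_RInt_eq;
      [|apply (is_RInt_derive (V := R_CompleteNormedModule)
          (fun th => powerRZ r p * sin (IZR p * th) / IZR p))].
    * rewrite Hsin, (Rmult_0_r (IZR p)), sin_0.
      unfold minus, plus, opp; simpl; field; trivial.
    * intros th _; auto_derive; trivial; field; trivial.
    * intros th _; exact (proj1 (ccont_circpow r p th)).
  + eapply is_RInt_eq;
      [|apply (is_RInt_derive (V := R_CompleteNormedModule)
          (fun th => - powerRZ r p * cos (IZR p * th) / IZR p))].
    * rewrite Hcos, (Rmult_0_r (IZR p)), cos_0.
      unfold minus, plus, opp; simpl; field; trivial.
    * intros th _; auto_derive; trivial; field; trivial.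
    * intros th _; exact (proj2 (ccont_circpow r p th)).
Qed.

Lemma eq0_of_geometric_bound a B r : 0 < r < 1 ->
  (exists n0, forall n, (n0 <= n)%nat -> Rabs a <= B * r ^ n) -> a = 0.
Proof.
intros Hr [n0 H].
destruct (Req_dec a 0) as [|Ha]; [assumption|exfalso].
assert (HB : 0 < Rabs B + 1) by (pose proof (Rabs_pos B); lra).
destruct (pow_lt_1_zero r) with (y := Rabs a / (Rabs B + 1)) as [n1 H1].
- rewrite Rabs_pos_eq; lra.
- apply Rdiv_lt_0_compat; [now apply Rabs_pos_lt|assumption].
- specialize (H (n0 + n1)%nat ltac:(lia)).
  specialize (H1 (n0 + n1)%nat ltac:(lia)).
  apply (Rmult_lt_compat_r _ _ _ HB) in H1.
  unfold Rdiv in H1; rewrite Rmult_assoc, Rinv_l, Rmult_1_r in H1 by lra.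
  assert (0 < r ^ (n0 + n1)) by (apply pow_lt; lra).
  rewrite Rabs_pos_eq in H1 by lra.
  pose proof (Rle_abs B); nra.
Qed.

Lemma Cmod_circpow_geom r p q th : 0 < r < 1 ->
  Cmod (circpow r p th * Cpow (geom r th) q) <= powerRZ r p * / (1 - r) ^ q.
Proof.
intros Hr; rewrite Cmod_mult, Cmod_circpow, Cmod_pow by lra.
apply Rmult_le_compat_l; [apply powerRZ_le; lra|].
rewrite <- pow_inv; apply pow_incr; split; [apply Cmod_ge_0|now apply Cmod_geom].
Qed.

Lemma Rabs_fst_le_Cmod (z : C) : Rabs (fst z) <= Cmod z.
Proof. eapply Rle_trans; [apply Rmax_l|apply Rmax_Cmod]. Qed.

Lemma Rabs_snd_le_Cmod (z : C) : Rabs (snd z) <= Cmod z.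
Proof. eapply Rle_trans; [apply Rmax_r|apply Rmax_Cmod]. Qed.

(* Both sides, as functions of [p], have the same backward difference by
   induction on [q], and both tend to [0] as [p] tends to infinity. *)
Lemma is_CInt_circpow_geom r q p : 0 < r < 1 ->
  is_CInt (fun th => Cmult (circpow r p th) (Cpow (geom r th) q))
          (RtoC (2 * PI * negbin q (- p))).
Proof.
intros Hr; revert p; induction q as [|q IH]; intros p.
{ apply is_CInt_ext with (circpow r p); [intros; simpl; ring|].
  apply is_CInt_circpow. }
set (f p th := Cmult (circpow r p th) (Cpow (geom r th) (S q))).
assert (Hf : forall p, exists v, is_CInt (f p) v).
{ intros p'; apply is_CInt_ccont, ccont_mult;
    [apply ccont_circpow|now apply ccont_pow, ccont_geom]. }
(* Writing $1 = (1-\xi) + \xi$ gives $\xi^p (1-\xi)^{-q-1} = \xi^p (1-\xi)^{-q} + \xi^{p+1}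
   (1-\xi)^{-q-1}$. *)
assert (Hrec : forall p v w, is_CInt (f p) v -> is_CInt (f (p + 1)%Z) w ->
  v = Cplus (RtoC (2 * PI * negbin q (- p))) w).
{ intros p' v w Hv Hw; apply is_CInt_unique with (1 := Hv).
  eapply is_CInt_ext; [|exact (is_CInt_plus _ _ _ _ (IH p') Hw)].
  intros th; unfold f; rewrite circpow_add, circpow_1 by lra; simpl.
  pose proof (one_minus_circ_neq0 r th Hr).
  unfold geom; field; assumption. }
(* Integral and claimed value obey the same recurrence, so the error of the formula does not change
   along [p + n]; it remains to see that it tends to 0. *)
assert (Hdiff : forall n v w, is_CInt (f p) v ->
  is_CInt (f (p + Z.of_nat n)%Z) w ->
  Cminus v (RtoC (2 * PI * negbin (S q) (- p)))
  = Cminus w (RtoC (2 * PI * negbin (S q) (- (p + Z.of_nat n))))).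
{ induction n as [|n IHn]; intros v w Hv Hw.
  - rewrite Z.add_0_r in *; now rewrite (is_CInt_unique _ _ _ Hv Hw).
  - destruct (Hf (p + Z.of_nat n)%Z) as [u Hu].
    rewrite (IHn v u Hv Hu).
    replace (p + Z.of_nat (S n))%Z with (p + Z.of_nat n + 1)%Z in * by lia.
    rewrite (Hrec _ _ _ Hu Hw).
    rewrite <- bdiff_negbin; unfold bdiff.
    replace (- (p + Z.of_nat n) - 1)%Z with (- (p + Z.of_nat n + 1))%Z by lia.
    apply injective_projections; simpl; ring. }
destruct (Hf p) as [v Hv].
(* For [n >= 1 - p] the degree [- (p + n)] is negative, so the claimed value is 0 and the error is
   the integral itself, which is of order [r ^ n]. *)
assert (Hb : forall n, (Z.to_nat (1 - p) <= n)%nat ->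
  Rabs (fst (Cminus v (RtoC (2 * PI * negbin (S q) (- p)))))
    <= 2 * PI * (powerRZ r p * / (1 - r) ^ S q) * r ^ n /\
  Rabs (snd (Cminus v (RtoC (2 * PI * negbin (S q) (- p)))))
    <= 2 * PI * (powerRZ r p * / (1 - r) ^ S q) * r ^ n).
{ intros n Hn; destruct (Hf (p + Z.of_nat n)%Z) as [w Hw].
  rewrite (Hdiff n v w Hv Hw), (negbin_neg (S q)) by lia.
  replace (Cminus w (RtoC (2 * PI * 0))) with w
    by (apply injective_projections; simpl; ring).
  assert (HB : forall th, Cmod (f (p + Z.of_nat n)%Z th)
     <= powerRZ r p * / (1 - r) ^ S q * r ^ n).
  { intros th; eapply Rle_trans; [now apply Cmod_circpow_geom|].
    rewrite powerRZ_add, <- pow_powerRZ by lra; right; ring. }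
  rewrite Rmult_assoc; destruct Hw as [Hw1 Hw2]; split.
  - apply (RInt_bound _ _ _ Hw1); intros th.
    eapply Rle_trans; [apply Rabs_fst_le_Cmod|apply HB].
  - apply (RInt_bound _ _ _ Hw2); intros th.
    eapply Rle_trans; [apply Rabs_snd_le_Cmod|apply HB]. }
replace (RtoC (2 * PI * negbin (S q) (- p))) with v; [exact Hv|].
apply injective_projections; apply Rminus_diag_uniq;
  eapply eq0_of_geometric_bound; try exact Hr; exists (Z.to_nat (1 - p));
  intros n Hn; destruct (Hb n Hn) as [Hb1 Hb2]; [exact Hb1|exact Hb2].
Qed.

(** Taylor's theorem will be applied to a real function; the free factor [w] lets the real part
    stand for the imaginary part as well, through multiplication by $-i$. *)
Lemma Derive_n_Re_exp (w z : C) n s :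
  is_derive_n (fun s : R => fst (w * Cexp (s * z))%C) n s
    (fst (w * Cpow z n * Cexp (s * z))%C).
Proof.
revert w s; induction n as [|n IH]; intros w s.
- change (fst (w * Cexp (s * z))%C = fst (w * 1 * Cexp (s * z))%C).
  now rewrite Cmult_1_r.
- apply (is_derive_ext (K := R_AbsRing) (V := R_NormedModule)
    (fun s : R => fst (w * Cpow z n * Cexp (s * z))%C)).
  { intros u; symmetry; apply is_derive_n_unique, IH. }
  replace (w * Cpow z (S n) * Cexp (s * z))%C
    with (w * Cpow z n * z * Cexp (s * z))%C by (simpl; ring).
  generalize (w * Cpow z n)%C; intros [a b]; destruct z as [c d]; simpl.
  auto_derive; [trivial|unfold Rminus; ring].
Qed.

Lemma Re_exp_Taylor (w z : C) (t : R) n : 0 <= t ->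
  Rabs (fst (w * Cexp (t * z))%C
        - sum_f_R0 (fun m => t ^ m / INR (fact m) * fst (w * Cpow z m)%C) n)
  <= t ^ S n / INR (fact (S n)) * (Cmod w * Cmod z ^ S n * exp (t * Cmod z)).
Proof.
intros Ht.
assert (Hfact := INR_fact_lt_0 (S n)).
assert (Hexp := exp_pos (t * Cmod z)).
assert (HM : 0 <= Cmod w * Cmod z ^ S n * exp (t * Cmod z)).
{ apply Rmult_le_pos; [|lra].
  apply Rmult_le_pos; [|apply pow_le]; apply Cmod_ge_0. }
assert (Hsum0 : forall u, Cexp (RtoC 0 * u)%C = RtoC 1).
{ intros u; unfold Cexp; simpl; rewrite !Rmult_0_l, Rminus_0_r, Rplus_0_r.
  rewrite exp_0, cos_0, sin_0; apply injective_projections; simpl; ring. }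
(* [Taylor_Lagrange] is applied on a nondegenerate interval, so [t = 0] is treated apart. *)
destruct (Req_dec t 0) as [->|Ht0].
{ rewrite Hsum0.
  replace (sum_f_R0 _ n) with (fst w).
  - replace (fst (w * 1)%C) with (fst w) by (simpl; ring).
    rewrite Rminus_diag_eq, Rabs_R0 by reflexivity.
    apply Rmult_le_pos; [|exact HM].
    apply Rmult_le_pos; [apply pow_le; lra|].
    left; now apply Rinv_0_lt_compat.
  - clear; induction n as [|n IH].
    + simpl; field.
    + rewrite tech5, <- IH; simpl; unfold Rdiv; ring. }
destruct (Taylor_Lagrange (fun s => fst (w * Cexp (s * z))%C) n 0 t)
  as [u [[Hu0 Hut] Hu]]; [lra| |].
{ intros s _ m _; destruct m; [exact I|].
  exact (ex_intro _ _ (Derive_n_Re_exp w z (S m) s)). }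
rewrite Hu, Rminus_0_r.
replace (sum_f_R0 _ n) with
  (sum_f_R0 (fun m => t ^ m / INR (fact m) * fst (w * Cpow z m)%C) n).
2:{ apply sum_eq; intros m _; f_equal.
    rewrite (is_derive_n_unique _ _ _ _ (Derive_n_Re_exp w z m 0)).
    rewrite Hsum0; now rewrite Cmult_1_r. }
rewrite Rplus_comm, Rplus_minus_r, Rabs_mult, Rabs_pos_eq.
2:{ apply Rmult_le_pos; [apply pow_le; lra|].
    left; now apply Rinv_0_lt_compat. }
apply Rmult_le_compat_l.
{ apply Rmult_le_pos; [apply pow_le; lra|].
  left; now apply Rinv_0_lt_compat. }
rewrite (is_derive_n_unique _ _ _ _ (Derive_n_Re_exp w z (S n) u)).
eapply Rle_trans; [apply Rabs_fst_le_Cmod|].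
rewrite !Cmod_mult, Cmod_pow.
apply Rmult_le_compat_l.
{ apply Rmult_le_pos; [|apply pow_le]; apply Cmod_ge_0. }
replace (Cmod (Cexp (u * z)%C)) with (exp (u * fst z)).
- enough (H : u * fst z <= t * Cmod z).
  { destruct H as [H| ->]; [left; now apply exp_increasing|now right]. }
  pose proof (Rabs_fst_le_Cmod z); pose proof (Rle_abs (fst z)).
  pose proof (Cmod_ge_0 z); nra.
- unfold Cmod, Cexp; simpl fst; simpl snd.
  replace (u * fst z - 0 * snd z) with (u * fst z) by ring.
  generalize (u * snd z + 0 * fst z); intros v.
  pose proof (sin2_cos2 v) as H; unfold Rsqr in H.
  set (e := exp _).
  replace (_ + _) with (e * e).
  + symmetry; apply sqrt_square; left; apply exp_pos.
  + transitivity (e * e * (sin v * sin v + cos v * cos v));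
    [rewrite H|]; ring.
Qed.

Lemma is_RInt_sum_f_R0 (f : nat -> R -> R) (v : nat -> R) a b n :
  (forall m, is_RInt (f m) a b (v m)) ->
  is_RInt (fun th => sum_f_R0 (fun m => f m th) n) a b (sum_f_R0 v n).
Proof.
intros H; induction n as [|n IH]; simpl; [apply H|].
exact (is_RInt_plus _ _ _ _ _ _ IH (H (S n))).
Qed.

Lemma is_lim_seq_pow_fact B a :
  is_lim_seq (fun n => B * (a ^ S n / INR (fact (S n)))) 0.
Proof.
replace (Finite 0) with (Rbar_mult B 0) by (simpl; f_equal; ring).
apply (is_lim_seq_scal_l (fun n => a ^ S n / INR (fact (S n)))).
apply (is_lim_seq_incr_1 (fun n => a ^ n / INR (fact n))).
apply is_lim_seq_Reals.
exact (cv_speed_pow_fact a).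
Qed.

(** On the circle $|1/\xi| = 1/r$ is constant, so the Taylor remainder of $e^{t/\xi}$ is bounded
    uniformly in the angle. The partial sums are integrated term by term, the [m]-th power of
    $1/\xi$ lowering [p] by [m], and the remainder tends to 0. *)
Lemma is_RInt_Re_circpow_geom_exp r q p t u : 0 < r < 1 -> 0 <= t ->
  is_RInt (fun th => fst (u * (circpow r p th * Cpow (geom r th) q)
                            * Cexp (t * circpow r (-1) th))%C) 0 (2 * PI)
    (2 * PI * fst u * egf (negbin q) (- p) t).
Proof.
intros Hr Ht.
set (f th := (u * (circpow r p th * Cpow (geom r th) q)
                            * Cexp (t * circpow r (-1) th))%C).
destruct (is_CInt_ccont f) as [v [Hv _]].
{ apply ccont_mult; [apply ccont_mult; [apply ccont_const|]|].
  - apply ccont_mult; [apply ccont_circpow|now apply ccont_pow, ccont_geom].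
  - apply ccont_exp, ccont_mult; [apply ccont_const|apply ccont_circpow]. }
set (S n := sum_f_R0 (egf_term (negbin q) (- p) t) n).
assert (HS : is_lim_seq (fun n => fst v - 2 * PI * fst u * S n)
                        (fst v - 2 * PI * fst u * egf (negbin q) (- p) t)).
{ apply is_lim_seq_minus'; [apply is_lim_seq_const|].
  apply (is_lim_seq_scal_l S _ (egf (negbin q) (- p) t)).
  apply is_lim_seq_Reals, is_series_Reals, egf_is_series, exp_growth_negbin. }
(* Length of the interval, times bounds on the circle for the factor in front of the exponential and
   for the exponential in the Lagrange remainder. *)
set (B := 2 * PI * (Cmod u * (powerRZ r p * / (1 - r) ^ q)) * exp (t * / r)).
assert (Hb : forall n, Rabs (fst v - 2 * PI * fst u * S n)
                       <= B * ((t * / r) ^ (n + 1) / INR (fact (n + 1)))).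
{ intros n; rewrite Nat.add_1_r.
  set (g m th := t ^ m / INR (fact m) *
    fst (u * (circpow r p th * Cpow (geom r th) q) * Cpow (circpow r (-1) th) m)%C).
  assert (Hg : is_RInt (fun th => sum_f_R0 (fun m => g m th) n) 0 (2 * PI)
                       (2 * PI * fst u * S n)).
  { unfold S; rewrite scal_sum; apply is_RInt_sum_f_R0; intros m.
    apply is_RInt_eq with (scal (t ^ m / INR (fact m))
       (fst (u * RtoC (2 * PI * negbin q (- (p - Z.of_nat m))))%C)).
    { unfold scal, egf_term; simpl; unfold mult; simpl.
      replace (- (p - Z.of_nat m))%Z with (- p + Z.of_nat m)%Z by lia; ring. }
    apply (is_RInt_scal (V := R_NormedModule)).
    destruct (is_CInt_scal u _ _ (is_CInt_circpow_geom r q (p - Z.of_nat m) Hr))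
      as [H _].
    eapply is_RInt_ext; [|exact H].
    intros th _; cbv beta; f_equal; rewrite circpow_pow by lra.
    replace (p - Z.of_nat m)%Z with (p + Z.of_nat m * -1)%Z by lia.
    rewrite circpow_add by lra; ring. }
  pose proof (is_RInt_minus _ _ _ _ _ _ Hv Hg) as Hd.
  replace (B * _) with (2 * PI * ((t * / r) ^ Datatypes.S n / INR (fact (Datatypes.S n))
    * ((Cmod u * (powerRZ r p * / (1 - r) ^ q)) * exp (t * / r))))
    by (unfold B; ring).
  apply (RInt_bound _ _ _ Hd); intros th.
  eapply Rle_trans; [apply (Re_exp_Taylor _ _ _ n Ht)|].
  rewrite Cmod_circpow by lra.
  replace (powerRZ r (-1)) with (/ r) by (simpl; field; lra).
  rewrite Rpow_mult_distr, Cmod_mult; unfold Rdiv.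
  pose proof (Cmod_circpow_geom r p q th Hr).
  assert (0 <= t ^ Datatypes.S n) by now apply pow_le.
  assert (0 < / INR (fact (Datatypes.S n)))
    by apply Rinv_0_lt_compat, INR_fact_lt_0.
  assert (0 < (/ r) ^ Datatypes.S n)
    by (apply pow_lt, Rinv_0_lt_compat; lra).
  pose proof (exp_pos (t * / r)); pose proof (Cmod_ge_0 u).
  match goal with |- ?a * ?b * (?c * ?d * ?e * ?f) <= _ =>
    replace (a * b * (c * d * e * f)) with (a * b * e * f * c * d) by ring;
    match goal with |- _ <= _ * (_ * ?k * _) =>
    transitivity (a * b * e * f * c * k); [|right; ring] end end.
  apply Rmult_le_compat_l; [|assumption].
  repeat match goal with |- 0 <= _ * _ => apply Rmult_le_pos end; lra. }
assert (H0 : is_lim_seq (fun n => fst v - 2 * PI * fst u * S n) 0).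
{ apply is_lim_seq_abs_0.
  apply is_lim_seq_le_le with (u := fun _ => 0)
    (w := fun n => B * ((t * / r) ^ (n + 1) / INR (fact (n + 1)))).
  - intros n; split; [apply Rabs_pos|apply Hb].
  - apply is_lim_seq_const.
  - eapply is_lim_seq_ext; [|apply is_lim_seq_pow_fact].
    intros n; simpl; rewrite Nat.add_1_r; reflexivity. }
assert (Heq := eq_trans (eq_sym (is_lim_seq_unique _ _ HS))
                        (is_lim_seq_unique _ _ H0)).
injection Heq as Heq.
apply is_RInt_eq with (fst v); [lra|exact Hv].
Qed.

Lemma is_CInt_circpow_geom_exp r q p t : 0 < r < 1 -> 0 <= t ->
  is_CInt (fun th => (circpow r p th * Cpow (geom r th) q
                      * Cexp (t * circpow r (-1) th))%C)
    (RtoC (2 * PI * egf (negbin q) (- p) t)).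
Proof.
intros Hr Ht; split; simpl fst; simpl snd.
- pose proof (is_RInt_Re_circpow_geom_exp r q p t 1 Hr Ht) as H.
  eapply is_RInt_eq; [|eapply is_RInt_ext; [|exact H]]; [simpl; ring|].
  intros th _; simpl; ring.
(* The imaginary part of a number is the real part of its product with $-i$; as $-i$ has real part
   0, this integral vanishes. *)
- pose proof (is_RInt_Re_circpow_geom_exp r q p t (- Ci)%C Hr Ht) as H.
  eapply is_RInt_eq; [|eapply is_RInt_ext; [|exact H]]; [simpl; ring|].
  intros th _; simpl; ring.
Qed.

End Contour.

(** * Iterated integrals of products, and the moments of the one-variable weight *)

Module IteratedIntegral.
Import Coquelicot.Coquelicot Egf Contour.

Lemma RI02pi_is_RInt (h : R -> R) v : RI02pi h v <-> is_RInt h 0 (2 * PI) v.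
Proof.
split.
- intros [pr Hpr]; rewrite <- Hpr, <- RInt_Reals.
  apply (RInt_correct (V := R_CompleteNormedModule)), ex_RInt_Reals_1, pr.
- intros H; assert (He : ex_RInt h 0 (2 * PI)) by now exists v.
  exists (ex_RInt_Reals_0 _ _ _ He).
  rewrite <- RInt_Reals; exact (is_RInt_unique _ _ _ _ H).
Qed.

Lemma IterInt_S n f g v : (forall th, IterInt n (fun l => f (th :: l)) (g th)) ->
  is_CInt g v -> IterInt (S n) f v.
Proof.
intros Hf [H1 H2]; apply IterIntS with g; [exact Hf| |];
  now apply RI02pi_is_RInt.
Qed.

Lemma IterInt_S_inv n f v : IterInt (S n) f v -> exists g,
  (forall th, IterInt n (fun l => f (th :: l)) (g th)) /\ is_CInt g v.
Proof.
intros H; inversion H as [|n' f' g v' Hg H1 H2]; subst.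
exists g; split; [exact Hg|split; now apply RI02pi_is_RInt].
Qed.

Lemma IterInt_0_inv f v : IterInt 0 f v -> v = f nil.
Proof. intros H; now inversion H. Qed.

Lemma IterInt_ext n f f' v : (forall l, length l = n -> f l = f' l) ->
  IterInt n f v -> IterInt n f' v.
Proof.
revert f f' v; induction n as [|n IH]; intros f f' v Hff H.
- apply IterInt_0_inv in H; rewrite H, Hff by reflexivity; constructor.
- apply IterInt_S_inv in H; destruct H as [g [Hg Hv]].
  apply IterInt_S with g; [|exact Hv].
  intros th; eapply IH; [|apply Hg].
  intros l Hl; apply Hff; simpl; now rewrite Hl.
Qed.

Lemma IterInt_add n f f' v v' : IterInt n f v -> IterInt n f' v' ->
  IterInt n (fun l => Cadd (f l) (f' l)) (Cadd v v').
Proof.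
revert f f' v v'; induction n as [|n IH]; intros f f' v v' H H'.
- rewrite (IterInt_0_inv _ _ H), (IterInt_0_inv _ _ H').
  apply (IterInt0 (fun l => Cadd (f l) (f' l))).
- apply IterInt_S_inv in H; destruct H as [g [Hg Hv]].
  apply IterInt_S_inv in H'; destruct H' as [g' [Hg' Hv']].
  apply IterInt_S with (fun th => Cadd (g th) (g' th)).
  + intros th; now apply IH.
  + exact (is_CInt_plus _ _ _ _ Hv Hv').
Qed.

Lemma IterInt_scal n c f v : IterInt n f v ->
  IterInt n (fun l => Cmul c (f l)) (Cmul c v).
Proof.
revert f v; induction n as [|n IH]; intros f v H.
- rewrite (IterInt_0_inv _ _ H); apply (IterInt0 (fun l => Cmul c (f l))).
- apply IterInt_S_inv in H; destruct H as [g [Hg Hv]].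
  apply IterInt_S with (fun th => Cmul c (g th)).
  + intros th; now apply IH.
  + exact (is_CInt_scal _ _ _ Hv).
Qed.

Lemma IterInt_0 n : IterInt n (fun _ => Cof 0) (Cof 0).
Proof.
induction n as [|n IH]; [apply (IterInt0 (fun _ => Cof 0))|].
apply IterInt_S with (fun _ => Cof 0); [now intros|].
destruct (is_CInt_ccont (fun _ => RtoC 0)) as [v Hv]; [apply ccont_const|].
replace (Cof 0) with (Cmult (RtoC 0) v)
  by (apply injective_projections; simpl; ring).
eapply is_CInt_ext; [|exact (is_CInt_scal (RtoC 0) _ _ Hv)].
intros th; apply injective_projections; simpl; ring.
Qed.

(** The inner integral is a constant for the outer one, so the factors come out one at a time.
    Removing the first angle shifts the indices, hence the induction over all families [G]. *)
Lemma IterInt_prod n (G : nat -> R -> Cx) (v : nat -> Cx) :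
  (forall i, is_CInt (G i) (v i)) ->
  IterInt n (fun l => Cprod (map (fun i => G i (nth i l 0)) (seq 0 n)))
            (Cprod (map v (seq 0 n))).
Proof.
revert G v; induction n as [|n IH]; intros G v H.
- apply (IterInt0 (fun _ => Cof 1)).
- set (w := Cprod (map (fun i => v (S i)) (seq 0 n))).
  apply IterInt_S with (fun th => Cmul (G 0%nat th) w).
  + intros th; apply (IterInt_ext n (fun l => Cmul (G 0%nat th)
      (Cprod (map (fun i => G (S i) (nth i l 0)) (seq 0 n))))).
    { intros l _; simpl; rewrite <- seq_shift, map_map; reflexivity. }
    apply IterInt_scal, (IH (fun i => G (S i)) (fun i => v (S i))).
    intros i; apply H.
  + simpl; rewrite <- seq_shift, map_map.
    change (is_CInt (fun th => Cmult (G 0%nat th) w) (Cmult (v 0%nat) w)).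
    rewrite Cmult_comm.
    eapply is_CInt_ext; [|apply is_CInt_scal, H].
    intros th; simpl; apply Cmult_comm.
Qed.

Lemma Defs_Cinv z : Defs.Cinv z = Cinv z.
Proof. unfold Defs.Cinv, Cinv; simpl; now rewrite !Rmult_1_r. Qed.

Lemma circpow_opp r p th : 0 < r -> circpow r (- p) th = Cinv (circpow r p th).
Proof.
intros Hr.
assert (H : circpow r p th <> 0).
{ apply Cmod_gt_0; rewrite Cmod_circpow by assumption; now apply powerRZ_lt. }
transitivity (circpow r (- p) th * circpow r p th * / circpow r p th)%C.
- field; exact H.
- rewrite <- circpow_add, Z.add_opp_diag_l, circpow_0 by lra.
  now rewrite Cmult_1_l.
Qed.

Lemma CpowZ_circ r p th : 0 < r -> CpowZ (circ r th) p = circpow r p th.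
Proof.
intros Hr; destruct p as [|p|p]; simpl CpowZ.
- now rewrite circpow_0.
- change Defs.Cpow with Cpow; rewrite <- circpow_nat by lra; f_equal; lia.
- change Defs.Cpow with Cpow; rewrite Defs_Cinv, <- circpow_nat, <- circpow_opp by lra.
  f_equal; lia.
Qed.

Lemma Cexp_add z w : Cexp (Cadd z w) = Cmul (Cexp z) (Cexp w).
Proof.
unfold Cexp; simpl; rewrite exp_plus, cos_plus, sin_plus.
apply injective_projections; simpl; ring.
Qed.

(** The part of [integrand] that depends on a single variable, Jacobian included. *)
Definition contour_weight (N : nat) (x : Z) (t : R) (xi : Cx) : Cx :=
  Cmul (Defs.Cinv (Defs.Cpow (Csub xi (Cof 1)) (N - 1)))
  (Cmul (CpowZ xi (x - Z.of_nat N - 1)%Z)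
  (Cmul (Cexp (Cmul (Ceps xi) (Cof t))) (Cmul Defs.Ci xi))).

Definition two_pi_i : Cx := (0, 2 * PI).

(** The sign turns $(\xi-1)^{-(N-1)}$ into a power of [geom]; the exponential is the constant part
    of $e^{\varepsilon(\xi)t} = e^{-t} e^{t/\xi}$. *)
Definition contour_scale (N : nat) (t : R) : R := (-1) ^ (N - 1) * exp (- t).

(** The signs cancel because $(N-1)N$ is even. *)
Lemma contour_scale_pow N t : contour_scale N t ^ N = exp (- (INR N * t)).
Proof.
unfold contour_scale; rewrite Rpow_mult_distr, <- pow_mult.
assert (He : exists m, ((N - 1) * N = 2 * m)%nat).
{ destruct (Nat.Even_or_Odd N) as [[m ->]|[m ->]].
  - exists ((2 * m - 1) * m)%nat; ring.
  - exists (m * (2 * m + 1))%nat; replace (2 * m + 1 - 1)%nat with (2 * m)%nat by lia; ring. }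
destruct He as [m ->]; rewrite pow_1_even, Rmult_1_l.
induction N as [|N IH]; [simpl; now rewrite Rmult_0_l, Ropp_0, exp_0|].
rewrite S_INR; simpl pow; rewrite IH, <- exp_plus; f_equal; ring.
Qed.

Lemma contour_weight_moment N x t r m : 0 < r < 1 -> 0 <= t ->
  is_CInt (fun th => Cmul (Defs.Cpow (circ r th) m)
                          (contour_weight N x t (circ r th)))
    (Cmul two_pi_i (Cof (contour_scale N t *
       egf (negbin (N - 1)) (Z.of_nat N - x - Z.of_nat m) t))).
Proof.
intros Hr Ht.
(* The exponent [x - N - 1] of the integrand, raised by 1 by the Jacobian $i\xi$ and by [m] by the
   monomial. *)
set (p := (x - Z.of_nat N + Z.of_nat m)%Z).
set (c := Cmult Ci (RtoC (contour_scale N t))).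
replace (Z.of_nat N - x - Z.of_nat m)%Z with (- p)%Z by (unfold p; lia).
replace (Cmul _ _) with
  (Cmult c (RtoC (2 * PI * egf (negbin (N - 1)) (- p) t)))
  by (apply injective_projections; simpl; ring).
eapply is_CInt_ext;
  [|exact (is_CInt_scal c _ _ (is_CInt_circpow_geom_exp r (N - 1) p t Hr Ht))].
intros th; unfold contour_weight.
rewrite CpowZ_circ, Defs_Cinv by lra; change Defs.Cpow with Cpow.
assert (Hexp : Cexp (Cmul (Ceps (circ r th)) (Cof t))
  = Cmult (RtoC (exp (- t))) (Cexp (Cmult t (circpow r (-1) th)))).
{ change (-1)%Z with (- (1))%Z; rewrite circpow_opp, circpow_1 by lra.
  unfold Ceps; rewrite Defs_Cinv.
  replace (Cmul _ _)
    with (Cadd (RtoC (- t)) (Cmult t (Cinv (circ r th))))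
    by (apply injective_projections; simpl; ring).
  rewrite Cexp_add; unfold Cmult, Cmul; f_equal; simpl.
  all: now rewrite cos_0, sin_0, Rmult_1_r, Rmult_0_r. }
rewrite Hexp; clear Hexp.
change Cmul with Cmult; change Defs.Ci with Ci.
replace p with (x - Z.of_nat N - 1 + 1 + Z.of_nat m)%Z by (unfold p; lia).
rewrite !circpow_add, circpow_1, circpow_nat by lra.
replace (/ (Csub (circ r th) (Cof 1)) ^ (N - 1))%C
  with (RtoC ((-1) ^ (N - 1)) * geom r th ^ (N - 1))%C.
- unfold c, contour_scale; rewrite RtoC_mult; ring.
- pose proof (one_minus_circ_neq0 r th Hr) as Hn.
  assert (Hn' : Csub (circ r th) (Cof 1) <> RtoC 0).
  { intros H; apply Hn.
    replace (1 - circ r th)%C with (- Csub (circ r th) (Cof 1))%C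
      by (apply injective_projections; simpl; ring).
    rewrite H; apply injective_projections; simpl; ring. }
  unfold geom; rewrite <- Cpow_inv, RtoC_pow, <- Cpow_mult_l by exact Hn'.
  f_equal.
  change (Csub (circ r th) (Cof 1)) with (circ r th - 1)%C in *.
  field; split; assumption.
Qed.

Lemma Cinv_Cpow_two_pi_i n :
  Cmul (Defs.Cinv (Defs.Cpow two_pi_i n)) (Defs.Cpow two_pi_i n) = Cof 1.
Proof.
rewrite Defs_Cinv; apply Cinv_l, Cpow_nz.
intros H; injection H as H; pose proof PI_RGT_0; lra.
Qed.

End IteratedIntegral.

(** * Label dynamics *)

Module Dynamics.

Lemma length_set_nth {A} (l : list A) i a : length (set_nth l i a) = length l.
Proof.
revert i; induction l as [|b l IH]; intros [|i]; simpl; trivial.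
now rewrite IH.
Qed.

Lemma nth_set_nth {A} (l : list A) i j a d : (i < length l)%nat ->
  nth j (set_nth l i a) d = if Nat.eqb j i then a else nth j l d.
Proof.
revert i j; induction l as [|b l IH]; simpl; intros i j Hi; [lia|].
destruct i as [|i], j as [|j]; simpl; trivial.
apply IH; lia.
Qed.

Lemma nth_nu N k j : (k <= N)%nat ->
  nth j (nu N k) 0%nat = if Nat.ltb j k then 2%nat
                         else if Nat.ltb j N then 1%nat else 0%nat.
Proof.
intros Hk; unfold nu; destruct (Nat.ltb_spec j k).
- rewrite app_nth1 by now rewrite repeat_length.
  now apply nth_repeat_lt.
- rewrite app_nth2; rewrite repeat_length; [|assumption].
  destruct (Nat.ltb_spec j N).
  + apply nth_repeat_lt; lia.
  + apply nth_overflow; rewrite repeat_length; lia.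
Qed.

(* Label-1 particles only move to earlier ranks, so once one of the first [k]
   ranks carries a label 1 the label word can never be [nu N k] again. *)
Definition dead (k : nat) (p : list nat) : Prop :=
  exists j, (j < k)%nat /\ nth j p 0%nat = 1%nat.

(** The exchange puts a label 1 at rank [i]. This is a new witness if [S i = k] and replaces a
    witness at [S i]; a witness away from both ranks is untouched. *)
Lemma dead_swap k p i :
  nth i p 0%nat = 2%nat -> nth (S i) p 0%nat = 1%nat ->
  dead k p \/ S i = k -> dead k (set_nth (set_nth p i 1%nat) (S i) 2%nat).
Proof.
intros H2 H1 Hd.
assert (Hi : (S i < length p)%nat).
{ destruct (Nat.lt_ge_cases (S i) (length p)) as [|Hge]; [assumption|].
  rewrite nth_overflow in H1 by assumption; lia. }
assert (Hn : forall j, nth j (set_nth (set_nth p i 1%nat) (S i) 2%nat) 0%nat =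
  if Nat.eqb j (S i) then 2%nat else if Nat.eqb j i then 1%nat else nth j p 0%nat).
{ intros j; rewrite !nth_set_nth; [reflexivity|lia|rewrite length_set_nth; lia]. }
assert (Hex : exists j, (j < k)%nat /\ (j = i \/ j <> i /\ j <> S i /\ nth j p 0%nat = 1%nat)).
{ destruct Hd as [[j [Hj Hpj]]|Hk]; [|exists i; lia].
  destruct (Nat.eq_dec j i) as [->|Hji]; [exists i; lia|].
  destruct (Nat.eq_dec j (S i)) as [->|Hjs]; [exists i; lia|].
  exists j; auto. }
destruct Hex as [j [Hj Hcase]]; exists j; split; [assumption|].
rewrite Hn; destruct Hcase as [->|[Hji [Hjs Hpj]]].
- destruct (Nat.eqb_spec i (S i)); [lia|now rewrite Nat.eqb_refl].
- destruct (Nat.eqb_spec j (S i)); [lia|].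
  destruct (Nat.eqb_spec j i); [lia|assumption].
Qed.

Lemma step_dead N k s i : dead k (snd s) -> dead k (snd (step N s i)).
Proof.
destruct s as [X p]; simpl; intros Hd.
destruct (_ && _)%bool; [|exact Hd].
destruct (Nat.eqb_spec (nth i p 0%nat) 2); [|exact Hd].
destruct (Nat.eqb_spec (nth (S i) p 0%nat) 1); [|exact Hd].
apply dead_swap; auto.
Qed.

Lemma cnt_dead N k x n s : (k <= N)%nat -> dead k (snd s) ->
  cnt N (Eevent N k x) n s = 0%nat.
Proof.
intros Hk; revert s; induction n as [|n IH]; intros s Hd; simpl.
- destruct s as [X p], Hd as [j [Hj Hp]]; simpl in *.
  destruct (list_eq_dec Nat.eq_dec p (nu N k)) as [->|]; [|reflexivity].
  rewrite nth_nu in Hp by assumption.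
  destruct (Nat.ltb_spec j k); lia.
- induction (seq 0 N) as [|i l IHl]; simpl; [reflexivity|].
  now rewrite IH, IHl by now apply step_dead.
Qed.

Definition increasing (N : nat) (X : list Z) : Prop :=
  length X = N /\
  forall i, (S i < N)%nat -> (nth i X 0 < nth (S i) X 0)%Z.

(** Three outcomes of a ring: killed, suppressed, or a free jump. The only neighbors labelled 2 then
    1 in [nu N k] have ranks [k - 1] and [k], counted from 0, so a jump onto an occupied site kills
    exactly when [S i = k]. *)
Lemma step_nu N k X i : (k <= N)%nat -> increasing N X -> (i < N)%nat ->
  (S i < N)%nat /\ nth (S i) X 0%Z = Z.succ (nth i X 0%Z) /\
    (S i = k /\ dead k (snd (step N (X, nu N k) i)) \/
     S i <> k /\ step N (X, nu N k) i = (X, nu N k)) \/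
  step N (X, nu N k) i = (set_nth X i (Z.succ (nth i X 0%Z)), nu N k) /\
    increasing N (set_nth X i (Z.succ (nth i X 0%Z))).
Proof.
intros Hk [HX Hinc] Hi; simpl step.
destruct (Nat.ltb_spec (S i) N) as [HSi|HSi]; simpl.
- destruct (Z.eqb_spec (nth (S i) X 0%Z) (nth i X 0%Z + 1)) as [He|He].
  + left; split; [assumption|split; [lia|]].
    destruct (Nat.eq_dec (S i) k) as [Hik|Hik]; [left|right]; split; trivial.
    * assert (H2 : nth i (nu N k) 0%nat = 2%nat).
      { rewrite nth_nu by assumption; destruct (Nat.ltb_spec i k); lia. }
      assert (H1 : nth (S i) (nu N k) 0%nat = 1%nat).
      { rewrite nth_nu by assumption.
        destruct (Nat.ltb_spec (S i) k); [lia|].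
        destruct (Nat.ltb_spec (S i) N); lia. }
      rewrite H1, H2; apply dead_swap; auto.
    * rewrite !nth_nu by assumption.
      destruct (Nat.ltb_spec i k), (Nat.ltb_spec (S i) k); simpl; trivial; try lia.
      destruct (Nat.ltb_spec i N); reflexivity.
  + right; split; [reflexivity|].
    split; [now rewrite length_set_nth|intros j Hj].
    rewrite !nth_set_nth by lia.
    pose proof (Hinc j Hj); pose proof (Hinc i HSi).
    destruct (Nat.eqb_spec j i), (Nat.eqb_spec (S j) i); subst; lia.
- right; split; [reflexivity|].
  split; [now rewrite length_set_nth|intros j Hj].
  rewrite !nth_set_nth by lia.
  pose proof (Hinc j Hj).
  destruct (Nat.eqb_spec j i), (Nat.eqb_spec (S j) i); subst; lia.
Qed.

Lemma Eevent_nu N k x X : Eevent N k x (X, nu N k) = true <->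
  forall j, (j < k)%nat -> nth j X 0%Z = (x + Z.of_nat j)%Z.
Proof.
unfold Eevent; destruct (list_eq_dec Nat.eq_dec (nu N k) (nu N k)); [|easy].
simpl; rewrite forallb_forall; split; intros H j Hj.
- apply Z.eqb_eq, H, in_seq; lia.
- apply Z.eqb_eq, H; apply in_seq in Hj; lia.
Qed.

Lemma nth_Yinit N j : (j < N)%nat -> nth j (Yinit N) 0%Z = Z.of_nat (S j).
Proof.
intros Hj; unfold Yinit; rewrite nth_indep with (d' := Z.of_nat 1)
  by now rewrite length_map, length_seq.
rewrite (map_nth (fun i => Z.of_nat (S i)) _ 0%nat), seq_nth; auto.
Qed.

Lemma increasing_Yinit N : increasing N (Yinit N).
Proof.
split; [unfold Yinit; now rewrite length_map, length_seq|].
intros i Hi; rewrite !nth_Yinit; lia.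
Qed.

End Dynamics.

(** * The free generator and its boundary conditions *)

Module Generator.
Import all_boot all_order all_algebra all_fingroup Rstruct Egf.
Import GRing.Theory.
Local Open Scope ring_scope.

Definition upd (i : nat) (f : Z -> Z) (Y : nat -> Z) : nat -> Z :=
  fun j => if j == i then f (Y j) else Y j.

Definition swap_next (j : nat) (Y : nat -> Z) : nat -> Z :=
  fun l => if l == j then Y j.+1 else if l == j.+1 then Y j else Y l.

(** The diagonal term $-N$ is left out, its effect being the factor $e^{-Nt}$. Configurations are
    arbitrary functions, so that coinciding positions, where the boundary conditions live, are
    allowed. *)
Definition gen (N : nat) (F : (nat -> Z) -> R) (Y : nat -> Z) : R :=
  \sum_(i < N) F (upd i Z.succ Y).

Lemma genE N F Y : gen N F Y = \sum_(i < N) F (upd i Z.succ Y).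
Proof. by []. Qed.

Definition antisym (j : nat) (F : (nat -> Z) -> R) : Prop :=
  forall Y, F (swap_next j Y) = - F Y.

Lemma upd_comm i j f g Y : (forall z, f (g z) = g (f z)) ->
  upd i f (upd j g Y) = upd j g (upd i f Y).
Proof.
move=> fg; apply: functional_extensionality => l; rewrite /upd.
by case: (l == i); case: (l == j).
Qed.

(** The free generator treats all particles alike, hence commutes with exchanging two of them:
    reindex the sum by the transposition. *)
Lemma gen_antisym N j F : (j.+1 < N)%N -> antisym j F -> antisym j (gen N F).
Proof.
move=> ltjN HF Y; have ltj : (j < N)%N by apply: ltnW.
rewrite /gen -sumrN (reindex_inj (@perm_inj _ (tperm (Ordinal ltj) (Ordinal ltjN)))).
apply: eq_bigr => i _; rewrite -HF; congr F.
apply: functional_extensionality => l; rewrite /upd /swap_next.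
have e1 : (j == j.+1) = false by exact: ltn_eqF.
have e2 : (j.+1 == j) = false by exact: gtn_eqF.
case: tpermP => [->|->|/eqP ni /eqP ni'] /=.
- case: (eqVneq l j) => [El|lj]; rewrite ?El ?eqxx ?e1 ?e2 //.
  by case: (eqVneq l j.+1) => [El|lj']; rewrite ?El ?eqxx ?e1 ?e2.
- case: (eqVneq l j) => [El|lj]; rewrite ?El ?eqxx ?e1 ?e2 //.
  by case: (eqVneq l j.+1) => [El|lj']; rewrite ?El ?eqxx ?e1 ?e2.
- have {}ni : (j == i) = false by rewrite eq_sym; apply: negbTE.
  have {}ni' : (j.+1 == i) = false by rewrite eq_sym; apply: negbTE.
  case: (eqVneq l j) => [El|lj]; rewrite ?El ?eqxx ?e1 ?e2 ?ni ?ni' //.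
  by case: (eqVneq l j.+1) => [El|lj']; rewrite ?El ?eqxx ?e1 ?e2 ?ni ?ni'.
Qed.

Lemma antisym_diag j F Y : antisym j F -> Y j.+1 = Y j -> F Y = 0.
Proof.
move=> HF eqY; have E : swap_next j Y = Y.
  apply: functional_extensionality => l; rewrite /swap_next.
  by case: eqP => [->|_] //; case: eqP => [->|_].
by apply/eqP; rewrite -Num.Theory.eqNr -HF E.
Qed.

Lemma iter_gen_antisym N n j F : (j.+1 < N)%N ->
  antisym j F -> antisym j (iter n (gen N) F).
Proof. by move=> ltjN HF; elim: n => //= n IH; apply: gen_antisym. Qed.

Lemma iter_gen_upd N n j f F Y : (forall z, Z.succ (f z) = f (Z.succ z)) ->
  iter n (gen N) (fun Y => F (upd j f Y)) Y = iter n (gen N) F (upd j f Y).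
Proof.
move=> Hf; elim: n Y => //= n IH Y.
by apply: eq_bigr => i _; rewrite IH upd_comm.
Qed.

Lemma eq_iter_gen N n F G Y : F =1 G -> iter n (gen N) F Y = iter n (gen N) G Y.
Proof.
by move=> FG; elim: n Y => //= n IH Y; apply: eq_bigr => i _; rewrite IH.
Qed.

Lemma iter_gen_sum N n (I : finType) (F : I -> (nat -> Z) -> R) (c : I -> R) Y :
  iter n (gen N) (fun Y => \sum_s c s * F s Y) Y =
  \sum_s c s * iter n (gen N) (F s) Y.
Proof.
elim: n Y => //= n IH Y; rewrite genE (eq_bigr _ (fun i _ => IH _)).
by rewrite exchange_big /=; apply: eq_bigr => s _; rewrite genE mulr_sumr.
Qed.

Lemma iter_genB N n F G Y :
  iter n (gen N) (fun Y => F Y - G Y) Y =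
  iter n (gen N) F Y - iter n (gen N) G Y.
Proof.
elim: n Y => //= n IH Y; rewrite genE (eq_bigr _ (fun i _ => IH _)).
by rewrite sumrB !genE.
Qed.

(** After the jump particles [j] and [j.+1] share a site, where an antisymmetric function vanishes;
    antisymmetry survives the iteration. *)
Lemma iter_gen_killed N n j F Y : (j.+1 < N)%N -> antisym j F ->
  Y j.+1 = Z.succ (Y j) -> iter n (gen N) F (upd j Z.succ Y) = 0.
Proof.
move=> ltjN HF eqY; apply: (@antisym_diag j); first exact: iter_gen_antisym.
by rewrite /upd eqxx (gtn_eqF (ltnSn j)).
Qed.

(** This is [iter_gen_killed] for the backward difference of [F] in [Y j], which commutes with
    [gen]; stepping back from the jumped configuration returns to [Y]. *)
Lemma iter_gen_blocked N n j F Y : (j.+1 < N)%N ->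
  antisym j (fun Y => F Y - F (upd j Z.pred Y)) ->
  Y j.+1 = Z.succ (Y j) ->
  iter n (gen N) F (upd j Z.succ Y) = iter n (gen N) F Y.
Proof.
move=> ltjN HF eqY; have := iter_gen_killed N n j _ Y ltjN HF eqY.
rewrite iter_genB (iter_gen_upd N n j Z.pred); last first.
  by move=> z; rewrite Z.succ_pred Z.pred_succ.
suff -> : upd j Z.pred (upd j Z.succ Y) = Y by move/eqP; rewrite subr_eq0 => /eqP.
apply: functional_extensionality => l; rewrite /upd.
by case: (l == j); rewrite ?Z.pred_succ.
Qed.

Definition pdet (N : nat) (g : nat -> nat -> Z -> R) (Y : nat -> Z) : R :=
  \det (\matrix_(j < N, i < N) g j i (Y j)).

Lemma pdet_antisym N g j : (j.+1 < N)%N -> (forall i z, g j.+1 i z = g j i z) ->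
  antisym j (pdet N g).
Proof.
move=> ltjN Hg Y; have ltj : (j < N)%N by apply: ltnW.
rewrite /pdet.
set s := tperm (Ordinal ltj) (Ordinal ltjN).
have neq : Ordinal ltj != Ordinal ltjN by rewrite -val_eqE /= (ltn_eqF (ltnSn j)).
set A := (X in _ = - \det X).
suff -> : (\matrix_(j0, i) g j0 i (swap_next j Y j0)) = row_perm s A.
  by rewrite row_permE det_mulmx det_perm odd_tperm neq expr1 mulN1r.
apply/matrixP => a i; rewrite !mxE /s /swap_next.
case: tpermP => [->|->|/eqP na /eqP na'] /=.
- by rewrite eqxx Hg.
- by rewrite eqxx (gtn_eqF (ltnSn j)) Hg.
- have -> : (nat_of_ord a == j) = false by apply: negbTE.
  by have -> : (nat_of_ord a == j.+1) = false by apply: negbTE.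
Qed.

Lemma pdet_pred N g j Y : (j < N)%N ->
  pdet N g Y - pdet N g (upd j Z.pred Y) =
  pdet N (fun l i z => if l == j then g j i z - g j i (Z.pred z) else g l i z) Y.
Proof.
move=> ltj; apply/esym; rewrite -[pdet N g Y]mul1r -mulN1r.
have Hl a : (nat_of_ord (lift (Ordinal ltj) a) == j) = false.
  by rewrite /= eq_sym (negbTE (neq_bump _ _)).
apply: (@determinant_multilinear _ _ _ _ _ (Ordinal ltj)).
- by apply/rowP => i; rewrite !mxE /upd /= eqxx mul1r mulN1r.
- by apply/matrixP => a i; rewrite !mxE Hl.
- by apply/matrixP => a i; rewrite !mxE /upd Hl.
Qed.

(** By multilinearity the difference is the determinant whose row [j] is replaced by its backward
    difference, that is by the function of row [j.+1]; two rows then share one function. *)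
Lemma pdet_blocked N g j : (j.+1 < N)%N ->
  (forall i z, g j.+1 i z = g j i z - g j i (Z.pred z)) ->
  antisym j (fun Y => pdet N g Y - pdet N g (upd j Z.pred Y)).
Proof.
move=> ltjN Hg Y; rewrite !pdet_pred ?(ltnW ltjN) //.
apply: pdet_antisym => // i z.
by rewrite eqxx (gtn_eqF (ltnSn j)) Hg.
Qed.

End Generator.

(** * The determinant counting the histories of the killed process *)

Module CountDet.
Import all_boot all_order all_algebra all_fingroup Rstruct zify.
Import Egf Generator Dynamics.
Import GRing.Theory.
Local Open Scope ring_scope.

(** The exponent $e_j$. For [0 < k] its value at [k.-1] is repeated at [k], which encodes the
    killing between these two ranks. *)
Definition colexp (k j : nat) : nat := if (j < k)%N then j else j.-1.

(* Each backward difference multiplies a generating function by [1 - w], so this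
   is the coefficient of [w^(z - x - i)] in [(1 - w)^(colexp k j - i)]. *)
Definition entry (N k : nat) (x : Z) (j i : nat) (z : Z) : R :=
  Nat.iter (N.-1 - i + colexp k j) bdiff (negbin N.-1)
    (Z.sub (Z.sub z x) (Z.of_nat i)).

Lemma entry_same N k x j i z : j.+1 = k ->
  entry N k x j.+1 i z = entry N k x j i z.
Proof. by move=> <-; rewrite /entry /colexp ltnn ltnSn. Qed.

Lemma entry_next N k x j i z : (0 < k)%N -> j.+1 != k ->
  entry N k x j.+1 i z = entry N k x j i z - entry N k x j i (Z.pred z).
Proof.
move=> k_gt0 neq; rewrite /entry.
have -> : colexp k j.+1 = (colexp k j).+1.
  by rewrite /colexp; case: (ltnP j.+1 k); case: (ltnP j k); lia.
rewrite addnS [LHS]/=.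
have -> : Z.sub (Z.sub (Z.pred z) x) (Z.of_nat i) =
          Z.pred (Z.sub (Z.sub z x) (Z.of_nat i)) by lia.
by [].
Qed.

Lemma negbin1 n : Z.le Z0 n -> negbin 1 n = 1.
Proof.
move=> n0; rewrite /=; case: Z.ltb_spec => [?|_]; first by exfalso; lia.
elim: (Z.to_nat n) => // m; rewrite tech5 => ->.
case: Z.eqb_spec => [?|_]; first by exfalso; lia.
by rewrite RplusE addr0.
Qed.

Section InitialDeterminant.
Variables (k l : nat) (x : Z) (Y : nat -> Z).
Let N := (k + l)%N.
Hypothesis k_gt0 : (0 < k)%N.
Hypothesis Y_incr : forall j, (j.+1 < N)%N -> Z.lt (Y j) (Y j.+1).

Let Y_gap a b : (a + b < N)%N -> Z.le (Z.add (Y a) (Z.of_nat b)) (Y (a + b)%N).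
Proof.
elim: b => [|b IH] ltN; first by rewrite addn0; lia.
have := Y_incr (a + b); rewrite -addnS => /(_ ltN).
have := IH (ltnW _); rewrite -ltnS -addnS => /(_ ltN); lia.
Qed.

Let entry_neg j i : (j < N)%N -> Z.lt (Y j) (Z.add x (Z.of_nat i)) ->
  entry N k x j i (Y j) = 0.
Proof. by move=> _ lt; rewrite /entry iter_bdiff_neg //; lia. Qed.

(** The exponent $e_j - i$ is nonnegative here, and the coefficient lies beyond the degree of the
    polynomial. *)
Let entry_far j i : (j < N)%N -> (i <= colexp k j)%N ->
  Z.lt (Z.add x (Z.of_nat (colexp k j))) (Y j) ->
  entry N k x j i (Y j) = 0.
Proof.
move=> ltj lei lt; rewrite /entry.
have -> : (N.-1 - i + colexp k j = Nat.add (colexp k j - i) N.-1)%N.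
  by move: lei; rewrite /colexp; case: (ltnP j k); lia.
by rewrite iter_bdiff_far //; lia.
Qed.

Let entry_diag j : (j < k)%N -> Y j = Z.add x (Z.of_nat j) ->
  entry N k x j j (Y j) = 1.
Proof.
move=> ltj eqY; rewrite /entry /colexp ltj.
have := iter_bdiff_negbin 0 N.-1 (Z.sub (Z.sub (Y j) x) (Z.of_nat j)).
have -> : (N.-1 - j + j = N.-1)%N by lia.
by rewrite Nat.add_0_r => ->; rewrite eqY /=; case: Z.eqb_spec => //; lia.
Qed.

(** The exponent $e_j - j$ is $-1$: these are the coefficients of the geometric series. *)
Let entry_diag1 j : (k <= j)%N -> (j < N)%N -> Z.le (Z.add x (Z.of_nat j)) (Y j) ->
  entry N k x j j (Y j) = 1.
Proof.
move=> lej ltj leY; rewrite /entry /colexp ltnNge lej /=.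
have := iter_bdiff_negbin 1 N.-2 (Z.sub (Z.sub (Y j) x) (Z.of_nat j)).
have -> : (N.-1 - j + j.-1 = N.-2)%N by lia.
have -> : Nat.add N.-2 1 = N.-1 by lia.
by move=> ->; rewrite negbin1 //; lia.
Qed.

Let det_row0 n (A : 'M[R]_n) (j : 'I_n) : (forall i, A j i = 0) -> \det A = 0.
Proof.
by move=> A0; rewrite (expand_det_row _ j) big1 // => i _; rewrite A0 mul0r.
Qed.

(** If [Y 0 < x] the first row is zero. Otherwise [Y j >= x + j] for all [j], the matrix is block
    triangular, and only the leading block of size [k] matters: it is unitriangular on the event and
    has a zero last row off it. *)
Lemma pdet_entry :
  ((forall j, (j < k)%N -> Y j = Z.add x (Z.of_nat j)) ->
    pdet N (entry N k x) Y = 1) /\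
  (~ (forall j, (j < k)%N -> Y j = Z.add x (Z.of_nat j)) ->
    pdet N (entry N k x) Y = 0).
Proof.
have N_gt0 : (0 < N)%N by rewrite /N; lia.
have [lt0|ge0] := Z_lt_le_dec (Y 0%N) x.
  split=> [/(_ _ k_gt0)|_]; first lia.
  apply: (@det_row0 _ _ (Ordinal N_gt0)) => i; rewrite !mxE /=.
  by apply: entry_neg => //; lia.
have Yge j : (j < N)%N -> Z.le (Z.add x (Z.of_nat j)) (Y j).
  by move=> ltj; have := Y_gap 0 j; rewrite add0n => /(_ ltj); lia.
(* For rows from [k] on, $e_j = j-1$ while [Y j >= x + j], so every entry left of the diagonal is
   zero and the diagonal ones are 1. *)
have -> : pdet N (entry N k x) Y =
    \det (\matrix_(j < k, i < k) entry N k x j i (Y j)).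
  rewrite /pdet -[X in \det X]submxK.
  have -> : dlsubmx (\matrix_(j < k + l, i < k + l) entry N k x j i (Y j)) = 0.
    apply/matrixP => j i; rewrite !mxE /=.
    have ltj : (k + j < N)%N by rewrite ltn_add2l.
    apply: entry_far => //; rewrite /colexp ltnNge leq_addr /=.
      by have := ltn_ord i; lia.
    by have := Yge _ ltj; lia.
  rewrite det_ublock -[\det (drsubmx _)]det_tr [\det _^T]det_trig; last first.
    apply/is_trig_mxP => i j ltij; rewrite !mxE /=.
    have ltj : (k + j < N)%N by rewrite ltn_add2l.
    apply: entry_far => //; rewrite /colexp ltnNge leq_addr /=; first by lia.
    by have := Yge _ ltj; lia.
  rewrite [X in _ * X]big1 ?mulr1 => [|j _].
    by congr (\det _); apply/matrixP => j i; rewrite !mxE.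
  have ltj : (k + j < N)%N by rewrite ltn_add2l.
  by rewrite !mxE /= entry_diag1 ?leq_addr //; apply: Yge.
split=> [Yeq|Yneq].
  rewrite det_trig; first by apply: big1 => j _; rewrite mxE entry_diag ?Yeq.
  apply/is_trig_mxP => j i ltji; rewrite !mxE.
  apply: entry_neg; first by have := ltn_ord j; rewrite /N; lia.
  by rewrite Yeq //; lia.
(* The last row of the block vanishes once [Y k.-1 > x + k.-1]. Equality is excluded: with gaps of
   at least 1 it would force [Y j = x + j] for every [j < k]. *)
have ltk : (k.-1 < k)%N by lia.
apply: (@det_row0 _ _ (Ordinal ltk)) => i; rewrite !mxE /=.
have ltkN : (k.-1 < N)%N by rewrite /N; lia.
apply: entry_far; rewrite // /colexp ltk; first by have := ltn_ord i; lia.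
have := Yge _ ltkN.
case: (Z.eq_dec (Y k.-1) (Z.add x (Z.of_nat k.-1))) => [Yk _|]; last lia.
case: Yneq => j ltj; have ltjN : (j < N)%N by rewrite /N; lia.
have := Yge _ ltjN; have := Y_gap j (k.-1 - j).
have -> : (j + (k.-1 - j) = k.-1)%N by lia.
by move=> /(_ ltkN); lia.
Qed.

End InitialDeterminant.

Lemma list_sum_big (f : nat -> nat) N :
  List.fold_right Nat.add 0%N (List.map f (List.seq 0 N)) = (\sum_(i < N) f i)%N.
Proof.
elim: N => [|N IH]; first by rewrite big_ord0.
rewrite List.seq_S List.map_app -/(list_sum _) List.list_sum_app /list_sum IH.
by rewrite big_ord_recr /= Nat.add_0_r.
Qed.

(** Induction on the number of rings, starting from [pdet_entry]. A killing ring contributes 0 on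
    both sides, a suppressed one is matched by [iter_gen_blocked], and a free jump is literally a
    term of [gen]. *)
Lemma cnt_eq_iter_gen N k x n X : (0 < k <= N)%N -> increasing N X ->
  INR (cnt N (Eevent N k x) n (X, nu N k)) =
  iter n (gen N) (pdet N (entry N k x)) (fun j => List.nth j X Z0).
Proof.
move=> /andP[k_gt0 lekN]; have lekN' : le k N by apply/leP.
elim: n X => [|n IH] X HX.
  have -> : cnt N (Eevent N k x) 0 (X, nu N k) =
    if Eevent N k x (X, nu N k) then 1%N else 0%N by [].
  rewrite [iter _ _ _ _]/=.
  have [l defN] : exists l, N = (k + l)%N by exists (N - k)%N; lia.
  case: (HX) => HXN Hinc; subst N.
  have [|H1 H0] := @pdet_entry k l x (fun j => List.nth j X Z0) k_gt0.
    by move=> j /ltP; apply: Hinc.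
  case E: (Eevent _ _ _ _).
    move/Eevent_nu: E => E; rewrite H1 // => j /ltP; exact: E.
  rewrite H0 // => Hall; move/negP: E; apply; apply/Eevent_nu => j /ltP.
  exact: Hall.
have -> : cnt N (Eevent N k x) n.+1 (X, nu N k) = list_sum (List.map
  (fun i => cnt N (Eevent N k x) n (step N (X, nu N k) i)) (List.seq 0 N)) by [].
rewrite /list_sum list_sum_big INRE natr_sum iterS genE; apply: eq_bigr => i _; rewrite -INRE.
have [|[Hi [Hadj Hcase]]|[-> Hinc]] := step_nu N k X i lekN' HX; first by apply/ltP.
  case: Hcase => [[Hk Hd]|[Hk ->]].
    rewrite (cnt_dead _ _ _ _ _ lekN' Hd).
    apply/esym/iter_gen_killed => //; first by apply/ltP.
    by apply: pdet_antisym => [|a z]; [apply/ltP|apply: entry_same].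
  rewrite IH //; apply/esym/iter_gen_blocked => //; first by apply/ltP.
  apply: pdet_blocked => [|a z]; first by apply/ltP.
  by apply: entry_next => //; apply/eqP.
rewrite IH //; congr (iter _ _ _ _); apply: functional_extensionality => j.
case: HX => HXN _; rewrite /upd nth_set_nth; last by rewrite HXN; apply/ltP.
by case: Nat.eqb_spec => [->|/eqP/negbTE ->]; rewrite ?eqxx.
Qed.

End CountDet.

(** * Evolution of determinants *)

Module EgfDet.
Import all_boot all_order all_algebra all_fingroup Rstruct zify ring.
Import Egf Generator.
Import GRing.Theory.
Local Open Scope ring_scope.

(** Pascal's rule, in the shape of the Leibniz rule for one more application of the generator. *)
Lemma conv_binomial (x y : nat -> R) n :
  \sum_(m < n.+2) 'C(n.+1, m)%:R * (x m * y (n.+1 - m)%N) =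
  \sum_(m < n.+1) 'C(n, m)%:R * (x m.+1 * y (n - m)%N + x m * y (n.+1 - m)%N).
Proof.
under [RHS]eq_bigr do rewrite mulrDr.
rewrite big_split /= big_ord_recl /= bin0 subn0 mul1r.
under eq_bigr do rewrite /bump add1n binS natrD mulrDl subSS.
rewrite big_split /= addrA addrC; congr (_ + _).
rewrite big_ord_recr /= bin_small // mul0r addr0 [RHS]big_ord_recl /=.
by rewrite bin0 mul1r subn0; congr (_ + _).
Qed.

Definition prodf (N : nat) (phi : nat -> Z -> R) (Y : nat -> Z) : R :=
  \prod_(j < N) phi j (Y j).

Lemma iter_gen_prodf_local N phi n Y Y' : (forall j, (j < N)%N -> Y j = Y' j) ->
  iter n (gen N) (prodf N phi) Y = iter n (gen N) (prodf N phi) Y'.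
Proof.
elim: n Y Y' => [|n IH] Y Y' eqY.
  by apply: eq_bigr => j _; rewrite eqY.
rewrite !iterS !genE; apply: eq_bigr => i _; apply: IH => j ltj.
by rewrite /upd eqY.
Qed.

(** The move of the last particle commutes with the generator of the others, so the power of their
    sum expands binomially. *)
Lemma iter_gen_prodfS N phi n Y :
  iter n (gen N.+1) (prodf N.+1 phi) Y =
  \sum_(m < n.+1) 'C(n, m)%:R *
    (iter m (gen N) (prodf N phi) Y * phi N (Z.add (Y N) (Z.of_nat (n - m)))).
Proof.
elim: n Y => [|n IH] Y.
  by rewrite big_ord1 bin0 mul1r /= /prodf big_ord_recr /= Z.add_0_r.
rewrite iterS genE big_ord_recr /= IH.
rewrite (eq_bigr _ (fun i _ => IH _)) exchange_big -big_split.
rewrite (conv_binomial (fun m => iter m (gen N) (prodf N phi) Y)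
  (fun m => phi N (Z.add (Y N) (Z.of_nat m)))).
apply: eq_bigr => m _; rewrite mulrDr; congr (_ + _).
  rewrite -mulr_sumr; congr (_ * _); rewrite iterS genE mulr_suml.
  apply: eq_bigr => i _; congr (_ * phi N (Z.add _ _)).
  by rewrite /upd gtn_eqF.
congr (_ * (_ * phi N _)).
  by apply: iter_gen_prodf_local => j ltj; rewrite /upd ltn_eqF.
by rewrite /upd eqxx; have := ltn_ord m; lia.
Qed.

(** The exponential of a sum of commuting moves is the product of their exponentials; each added
    particle is a Cauchy product. *)
Lemma prodf_series N phi Y t : (forall j, exp_growth (phi j)) ->
  abs_sum (fun n => t ^+ n / n`!%:R * iter n (gen N) (prodf N phi) Y)
          (\prod_(j < N) egf (phi j) (Y j) t).
Proof.
move=> Hphi; elim: N => [|N IH].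
  have -> : \prod_(j < 0) egf (phi j) (Y j) t =
      t ^+ 0 / 0`!%:R * iter 0 (gen 0) (prodf 0 phi) Y.
    by rewrite /= /prodf !big_ord0 expr0 divr1 mulr1.
  apply: (abs_sum_head (fun n => t ^+ n / n`!%:R * iter n (gen 0) (prodf 0 phi) Y)).
  by move=> n; rewrite iterS genE big_ord0 mulr0.
rewrite big_ord_recr /=.
have := abs_sum_conv _ _ _ _ IH (abs_sum_egf _ (Y N) t (Hphi N)).
apply: abs_sum_ext => n; rewrite /conv sum_f_R0E big_mkord iter_gen_prodfS mulr_sumr.
apply: eq_bigr => m _; rewrite /egf_term RpowE INRE factE !RmultE RdivE.
have lemn : (m <= n)%N by rewrite -ltnS.
have fact_neq0 p : p`!%:R != 0 :> R by rewrite Num.Theory.pnatr_eq0 -lt0n fact_gt0.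
have -> : t ^+ n = t ^+ m * t ^+ (n - m) by rewrite -exprD subnKC.
rewrite -(bin_fact lemn) !natrM minusE; field.
by rewrite !fact_neq0 Num.Theory.pnatr_eq0 -lt0n bin_gt0 lemn.
Qed.

Lemma abs_sum_sum (I : Type) (r : seq I) (a : I -> nat -> R) (v : I -> R) :
  (forall s, abs_sum (a s) (v s)) ->
  abs_sum (fun n => \sum_(s <- r) a s n) (\sum_(s <- r) v s).
Proof.
move=> Ha; elim: r => [|s r IH].
  apply: (abs_sum_ext (fun _ => 0)) => [n|]; first by rewrite big_nil.
  by rewrite big_nil; apply: (abs_sum_head (fun _ => 0)).
rewrite big_cons; have := abs_sum_add _ _ _ _ (Ha s) IH.
by apply: abs_sum_ext => n; rewrite big_cons.
Qed.

Lemma pdet_series N g Y t : (forall j i, exp_growth (g j i)) ->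
  abs_sum (fun n => t ^+ n / n`!%:R * iter n (gen N) (pdet N g) Y)
          (\det (\matrix_(j < N, i < N) egf (g j i) (Y j) t)).
Proof.
move=> Hg.
(* [prodf] indexes its factors by [nat]; the default 0 concerns only [j >= N], outside the
   product. *)
pose phi (s : 'S_N) (j : nat) : Z -> R :=
  g j (if insub j is Some j' then (s j' : nat) else 0%N).
have phiE s (j : 'I_N) : phi s j = g j (s j) by rewrite /phi valK.
have pdetE : pdet N g =1 fun Y => \sum_(s : 'S_N) (-1) ^+ s * prodf N (phi s) Y.
  move=> Y'; apply: eq_bigr => s _; congr (_ * _).
  by apply: eq_bigr => j _; rewrite mxE phiE.
have -> : \det (\matrix_(j < N, i < N) egf (g j i) (Y j) t) =
    \sum_(s : 'S_N) (-1) ^+ s * \prod_(j < N) egf (phi s j) (Y j) t.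
  apply: eq_bigr => s _; congr (_ * _).
  by apply: eq_bigr => j _; rewrite mxE phiE.
have := abs_sum_sum _ (index_enum _) _ _ (fun s : 'S_N =>
  abs_sum_scal ((-1) ^+ s) _ _ (prodf_series N (phi s) Y t (fun j => Hg _ _))).
apply: abs_sum_ext => n.
rewrite (eq_iter_gen _ _ _ _ _ pdetE) iter_gen_sum mulr_sumr.
by apply: eq_bigr => s _; rewrite mulrCA.
Qed.

Lemma coef_one_subX_exp p a : (p < a)%N -> ((1 - 'X) ^+ p : {poly R})`_a = 0.
Proof.
move=> ltpa; apply/nth_default/(leq_trans (size_poly_exp_leq _ _)).
by rewrite -opprB size_polyN -polyC1 size_XsubC mul1n.
Qed.

(** [bdiff] is 1 minus the backward shift, expanded binomially; zero coefficients pad the sum to [N]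
    terms so that it becomes a matrix product. *)
Lemma iter_bdiff_sum N p f z : (p < N)%N ->
  Nat.iter p bdiff f z =
  \sum_(a < N) ((1 - 'X) ^+ p : {poly R})`_a * f (Z.sub z (Z.of_nat a)).
Proof.
elim: p z => [|p IH] z ltp.
  case: N ltp => // N _; rewrite big_ord_recl /= coef1 mul1r Z.sub_0_r.
  by rewrite big1 ?addr0 // => i _; rewrite coef1 mul0r.
have -> : Nat.iter p.+1 bdiff f z =
  Nat.iter p bdiff f z - Nat.iter p bdiff f (Z.pred z) by [].
rewrite !IH ?(ltnW ltp) //; under [RHS]eq_bigr do
  rewrite exprS mulrBl mul1r coefB coefXM mulrBl.
rewrite sumrB; congr (_ - _); case: N ltp {IH} => // N ltp.
rewrite big_ord_recr [RHS]big_ord_recl /= mul0r add0r.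
rewrite coef_one_subX_exp // mul0r addr0.
by apply: eq_bigr => i _; congr (_ * f _); lia.
Qed.

End EgfDet.

(** * Reduction to a Hankel determinant *)

Module Hankel.
Import all_boot all_order all_algebra all_fingroup Rstruct zify ring.
Import Egf EgfDet.
Import GRing.Theory.
Local Open Scope ring_scope.

(** Reversing [n.+1] elements sends the first to the end, at the cost of [n] inversions, and
    reverses the remaining ones. *)
Lemma odd_rev_perm n :
  (-1) ^+ (perm (@rev_ord_inj n)) = (-1) ^+ Nat.div (Nat.mul n (Nat.sub n 1)) 2 :> R.
Proof.
rewrite -[RHS]signr_odd; congr (_ ^+ nat_of_bool _).
elim: n => [|n IH].
  suff -> : perm (@rev_ord_inj 0) = 1%g by rewrite odd_perm1.
  by apply/permP => -[].
have -> : perm (@rev_ord_inj n.+1) =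
    lift_perm ord0 ord_max (perm (@rev_ord_inj n)).
  apply/permP => i; rewrite permE; apply: val_inj => /=.
  case: (unliftP ord0 i) => [j ->|->].
    rewrite lift_perm_lift /= permE /= /bump leq0n.
    by have := ltn_ord j; case: leqP; lia.
  by rewrite lift_perm_id /=; lia.
rewrite odd_lift_perm IH.
have -> : Nat.mul n.+1 (Nat.sub n.+1 1) = Nat.add (Nat.mul n (Nat.sub n 1)) (Nat.mul n 2).
  by case: n {IH} => // n; nia.
by rewrite Nat.div_add // oddD addbC.
Qed.

(** Row [i] lists the coefficients of $X^i (1-X)^{e_i}$, cut at degree [N]. *)
Definition upper (N : nat) (e : nat -> nat) : 'M[R]_N :=
  \matrix_(i, l) if (i <= l)%N then ((1 - 'X) ^+ e i : {poly R})`_(l - i) else 0.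

Lemma det_upper N e : \det (upper N e) = 1.
Proof.
rewrite -det_tr det_trig; last first.
  by apply/is_trig_mxP => l i ltli; rewrite !mxE leqNgt ltli.
rewrite big1 // => i _; rewrite !mxE leqnn subnn.
by rewrite -horner_coef0 !hornerE ?subr0 expr1n.
Qed.

(** The bound says that cutting at degree [N] loses nothing of row [i]. *)
Lemma upper_sum N (e : nat -> nat) (F : nat -> R) (i : 'I_N) : (i + e i < N)%N ->
  \sum_(l < N) upper N e i l * F l =
  \sum_(a < N) ((1 - 'X) ^+ e i : {poly R})`_a * F (i + a)%N.
Proof.
move=> lte; set c := fun a => ((1 - 'X) ^+ e i : {poly R})`_a.
have -> : \sum_(l < N) upper N e i l * F l =
    \sum_(0 <= l < N) (if (i <= l)%N then c (l - i)%N * F l else 0).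
  rewrite big_mkord; apply: eq_bigr => l _; rewrite mxE.
  by case: ifP => // _; rewrite mul0r.
rewrite (@big_cat_nat _ _ _ i) //=; last exact: ltnW.
rewrite big_nat_cond big1 ?add0r => [|l]; last first.
  by rewrite andbT leq0n /= => ltli; rewrite leqNgt ltli.
rewrite -[in LHS](add0n (nat_of_ord i)) big_addn add0n -(big_mkord xpredT
  (fun a => c a * F (i + a)%N)) [RHS](@big_cat_nat _ _ _ (N - i)) ?leq_subr //=.
rewrite [X in _ = _ + X]big_nat_cond [X in _ = _ + X]big1 ?addr0 => [|a].
  by apply: eq_bigr => a _; rewrite leq_addl addnK addnC.
rewrite andbT => /andP[lea _]; rewrite /c coef_one_subX_exp ?mul0r //.
by move: lte lea; lia.
Qed.

(** With $j' = N-1-j$ the argument is $N - y - (j' + i)$, a Hankel pattern, and a backward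
    difference raises the row or column index. As $e_j \le j$, rows reach at most $j' + e_j \le
    N-1$, and columns $i + (N-1-i) = N-1$, so both changes of basis stay within size [N]. Only the
    reversal of rows costs a sign, and [e] drops out. *)
Lemma det_bdiff_hankel N (e : nat -> nat) (M : Z -> R) (y : Z) :
  (forall j, (e j <= j)%N) ->
  \det (\matrix_(j < N, i < N) Nat.iter (N.-1 - i + e j) bdiff M
          (Z.sub (Z.sub (Z.of_nat j.+1) y) (Z.of_nat i))) =
  (-1) ^+ Nat.div (Nat.mul N (Nat.sub N 1)) 2 *
  \det (\matrix_(i < N, l < N)
          M (Z.sub (Z.sub (Z.of_nat N) y) (Z.of_nat (i + l)))).
Proof.
move=> lee; set H := (X in _ = _ * \det X).
pose e' i := e (N.-1 - i)%N.
set A := (X in \det X = _).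
have -> : A = row_perm (perm (@rev_ord_inj N)) (upper N e') *m H *m
    (upper N (fun i => N.-1 - i)%N)^T.
  apply/matrixP => j i; rewrite mxE.
  have -> : Nat.iter (N.-1 - i + e j) bdiff M
      (Z.sub (Z.sub (Z.of_nat j.+1) y) (Z.of_nat i)) =
    Nat.iter (N.-1 - i) bdiff (Nat.iter (e j) bdiff M)
      (Z.sub (Z.sub (Z.of_nat j.+1) y) (Z.of_nat i)).
    by rewrite -Nat.iter_add.
  have lti := ltn_ord i; have ltj := ltn_ord j; have leej := lee j.
  rewrite (@iter_bdiff_sum N); last by lia.
  pose B l := Nat.iter (e j) bdiff M
    (Z.sub (Z.sub (Z.of_nat j.+1) y) (Z.of_nat l)).
  transitivity (\sum_(l < N) upper N (fun i => N.-1 - i)%N i l * B l).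
    rewrite upper_sum; last by lia.
    apply: eq_bigr => a _; congr (_ * _).
    by apply: (f_equal (Nat.iter (e j) bdiff M)); lia.
  rewrite mxE; apply: eq_bigr => l _; rewrite [_^T _ _]mxE mulrC; congr (_ * _).
  rewrite /B (@iter_bdiff_sum N); last by lia.
  pose C l' := M (Z.sub (Z.sub (Z.of_nat N) y) (Z.of_nat (l' + l))).
  have eE : e' (rev_ord j) = e j by rewrite /e' /=; congr e; lia.
  transitivity (\sum_(l' < N) upper N e' (rev_ord j) l' * C l').
    rewrite upper_sum eE; last by rewrite /=; lia.
    have -> : nat_of_ord (rev_ord j) = (N - j.+1)%N by [].
    by apply: eq_bigr => b _; rewrite /C; congr (_ * M _); lia.
  by rewrite mxE; apply: eq_bigr => l' _; rewrite [H _ _]mxE [row_perm _ _ _ _]mxE permE.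
by rewrite !det_mulmx det_tr row_permE det_mulmx det_perm !det_upper !mulr1 odd_rev_perm.
Qed.

End Hankel.

(** * Assembling the contour integral *)

Module ComplexRing.
Import HB.structures all_boot all_order all_algebra all_fingroup Rstruct ring.
Import GRing.Theory.
Local Open Scope ring_scope.

Definition Copp (z : Cx) : Cx := (- fst z, - snd z).

Lemma Cx_addA : associative Cadd.
Proof. by move=> x y z; apply: injective_projections; rewrite /= !RplusE addrA. Qed.
Lemma Cx_addC : commutative Cadd.
Proof. by move=> x y; apply: injective_projections; rewrite /= RplusE addrC. Qed.
Lemma Cx_add0 : left_id (Cof 0) Cadd.
Proof. by move=> x; apply: injective_projections; rewrite /= RplusE add0r. Qed.
Lemma Cx_addN : left_inverse (Cof 0) Copp Cadd.
Proof. by move=> x; apply: injective_projections; rewrite /= RplusE addNr. Qed.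
Lemma Cx_mulA : associative Cmul.
Proof.
by move=> x y z; apply: injective_projections => /=;
  rewrite ?R0E ?R1E ?RplusE ?RminusE ?RmultE; ring.
Qed.
Lemma Cx_mulC : commutative Cmul.
Proof.
by move=> x y; apply: injective_projections => /=;
  rewrite ?R0E ?R1E ?RplusE ?RminusE ?RmultE; ring.
Qed.
Lemma Cx_mul1 : left_id (Cof 1) Cmul.
Proof.
by move=> x; apply: injective_projections => /=;
  rewrite ?R0E ?R1E ?RplusE ?RminusE ?RmultE; ring.
Qed.
Lemma Cx_mulD : left_distributive Cmul Cadd.
Proof.
by move=> x y z; apply: injective_projections => /=;
  rewrite ?R0E ?R1E ?RplusE ?RminusE ?RmultE; ring.
Qed.

HB.instance Definition _ := Choice.copy Cx (R * R)%type.
HB.instance Definition _ :=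
  GRing.isZmodule.Build Cx Cx_addA Cx_addC Cx_add0 Cx_addN.

Lemma Cx_1neq0 : Cof 1 != 0 :> Cx.
Proof. by apply/eqP => -[] /eqP; rewrite oner_eq0. Qed.

HB.instance Definition _ :=
  GRing.Zmodule_isComNzRing.Build Cx Cx_mulA Cx_mulC Cx_mul1 Cx_mulD Cx_1neq0.

Lemma Cof_zmod : zmod_morphism Cof.
Proof.
by move=> x y; apply: injective_projections; rewrite //= RplusE subr0.
Qed.

Lemma Cof_monoid : monoid_morphism Cof.
Proof.
split=> // x y; apply: injective_projections => /=;
  rewrite ?R0E ?R1E ?RplusE ?RminusE ?RmultE; ring.
Qed.

HB.instance Definition _ := GRing.isZmodMorphism.Build R Cx Cof Cof_zmod.
HB.instance Definition _ := GRing.isMonoidMorphism.Build R Cx Cof Cof_monoid.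

Lemma CmulE (x y : Cx) : Cmul x y = x * y. Proof. by []. Qed.

Lemma CpowE z n : Cpow z n = z ^+ n.
Proof. by elim: n => //= n ->; rewrite exprS. Qed.

Lemma Cprod_cat s t : Cprod (s ++ t)%list = Cprod s * Cprod t.
Proof. by elim: s => [|a s IH] /=; [rewrite mul1r|rewrite IH !CmulE mulrA]. Qed.

Lemma Cprod_map (f : nat -> Cx) n :
  Cprod (List.map f (List.seq 0 n)) = \prod_(i < n) f i.
Proof.
elim: n => [|n IH]; first by rewrite big_ord0.
rewrite List.seq_S List.map_app Cprod_cat IH big_ord_recr /=; congr (_ * _).
exact: mulr1.
Qed.

Lemma Cprod_flat_map (g : nat -> list Cx) n :
  Cprod (List.flat_map g (List.seq 0 n)) = \prod_(i < n) Cprod (g i).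
Proof.
elim: n => [|n IH]; first by rewrite big_ord0.
rewrite List.seq_S List.flat_map_app Cprod_cat IH big_ord_recr /=.
by rewrite List.app_nil_r.
Qed.

(** The product is the square of a Vandermonde determinant; expanding both copies over permutations
    separates the variables. *)
Lemma Vandermonde_sqr (xi : nat -> Cx) N :
  Cprod (List.flat_map (fun j => List.map (fun i =>
    Cpow (Csub (xi j) (xi i)) 2) (List.seq 0 j)) (List.seq 0 N)) =
  \sum_(s : 'S_N) \sum_(t : 'S_N) ((-1) ^+ s * (-1) ^+ t) *
    \prod_(i < N) xi i ^+ (s i + t i).
Proof.
have -> : Cprod (List.flat_map (fun j => List.map (fun i =>
    Cpow (Csub (xi j) (xi i)) 2) (List.seq 0 j)) (List.seq 0 N)) =
  (\det (Vandermonde N (\row_(i < N) xi i))) ^+ 2.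
  rewrite Cprod_flat_map det_Vandermonde.
  rewrite [in RHS](exchange_big_dep xpredT) //= -prodrXl.
  apply: eq_bigr => j _; rewrite Cprod_map -prodrXl.
  rewrite (big_ord_widen N (fun i => Cpow (Csub (xi j) (xi i)) 2)).
    by apply: eq_bigr => i _; rewrite CpowE !mxE.
  exact: ltnW.
rewrite -det_tr expr2 /determinant mulr_suml; apply: eq_bigr => s _.
rewrite mulr_sumr; apply: eq_bigr => t _.
rewrite mulrACA -big_split /=; congr (_ * _); apply: eq_bigr => i _.
by rewrite !mxE exprD.
Qed.

(** For fixed [s] the inner sum is the sign of [s] times the determinant of [A] with rows permuted
    by [s], that is [\det A]. *)
Lemma sum_perm2_det n (A : 'M[R]_n) :
  \sum_(s : 'S_n) \sum_(t : 'S_n) ((-1) ^+ s * (-1) ^+ t) *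
    \prod_(i < n) A (s i) (t i) = n`!%:R * \det A.
Proof.
rewrite (eq_bigr (fun _ => \det A)) => [|s _].
  by rewrite sumr_const card_Sn mulr_natl.
transitivity ((-1) ^+ s * \det (row_perm s A)); last first.
  by rewrite row_permE det_mulmx det_perm mulrA -signr_addb addbb mul1r.
rewrite mulr_sumr; apply: eq_bigr => t _; rewrite -mulrA.
by congr (_ * (_ * _)); apply: eq_bigr => i _; rewrite mxE.
Qed.

End ComplexRing.

(** * Both sides of the formula as one Hankel determinant *)

Module TasepProbability.
Import all_boot all_order all_algebra all_fingroup Rstruct zify ring.
Import Egf Contour IteratedIntegral Dynamics Generator CountDet EgfDet Hankel ComplexRing.
Import GRing.Theory.
Local Open Scope ring_scope.

Local Arguments Cof a%_ring_scope.
Local Arguments tasep_prob_is N s E (t P)%_ring_scope.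

Lemma IterInt_sum (I : Type) (s : seq I) n (f : I -> list R -> Cx) (v : I -> Cx) :
  (forall a, IterInt n (f a) (v a)) ->
  IterInt n (fun l => \sum_(a <- s) f a l) (\sum_(a <- s) v a).
Proof.
move=> Hf; elim: s => [|a s IH].
  rewrite big_nil; apply: (IterInt_ext n (fun _ => 0)); last exact: IterInt_0.
  by move=> l _; rewrite big_nil.
rewrite big_cons; apply: IterInt_ext (IterInt_add _ _ _ _ _ (Hf a) IH).
by move=> l _; rewrite big_cons.
Qed.

Definition moment (N : nat) (x : Z) (t : R) (m : nat) : R :=
  egf (negbin N.-1) (Z.sub (Z.sub (Z.of_nat N) x) (Z.of_nat m)) t.

Definition hankel (N : nat) (x : Z) (t : R) : 'M[R]_N :=
  \matrix_(i < N, j < N) moment N x t (i + j)%N.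

(** After [Vandermonde_sqr] each term is a product of one-variable integrals, evaluated by
    [contour_weight_moment]; [sum_perm2_det] then gathers the double sum over permutations. *)
Lemma IterInt_integrand N x t r : Rle R0 t -> (Rlt R0 r /\ Rlt r R1) ->
  IterInt N (integrand N x t r)
    (two_pi_i ^+ N * Cof (contour_scale N t ^+ N * (N`!%:R * \det (hankel N x t)))).
Proof.
move=> t0 r01.
(* Extended by 0 beyond [N], since [IterInt_prod] takes families indexed by [nat]. *)
pose m (s u : 'S_N) (j : nat) :=
  if insub j is Some j' then (s j' + u j')%N else 0%N.
have mE s u (i : 'I_N) : m s u i = (s i + u i)%N by rewrite /m valK.
pose G s u j th := Cmul (Cpow (circ r th) (m s u j)) (contour_weight N x t (circ r th)).
pose v s u j := Cmul two_pi_i (Cof (contour_scale N t * moment N x t (m s u j))).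
have Gv s u j : is_CInt (G s u j) (v s u j).
  have := contour_weight_moment N x t r (m s u j) r01 t0.
  by rewrite minusE subn1.
have -> : two_pi_i ^+ N * Cof (contour_scale N t ^+ N * (N`!%:R * \det (hankel N x t))) =
    \sum_(s : 'S_N) \sum_(u : 'S_N)
      ((-1) ^+ s * (-1) ^+ u) * Cprod (List.map (v s u) (List.seq 0 N)).
  rewrite -(sum_perm2_det N (hankel N x t)) mulr_sumr rmorph_sum mulr_sumr; apply: eq_bigr => s _.
  rewrite mulr_sumr rmorph_sum mulr_sumr; apply: eq_bigr => u _.
  rewrite Cprod_map /v big_split /= prodr_const card_ord -rmorph_prod big_split /=.
  rewrite prodr_const card_ord !rmorphM !rmorph_sign !rmorphXn.
  rewrite (eq_bigr (fun i : 'I_N => moment N x t (m s u i))) => [|i _]; last first.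
    by rewrite mxE mE.
  by rewrite [X in two_pi_i ^+ N * X = _]mulrCA [LHS]mulrCA.
have := IterInt_sum _ (index_enum _) N _ _ (fun s : 'S_N =>
  IterInt_sum _ (index_enum _) N _ _ (fun u : 'S_N =>
    IterInt_scal N ((-1) ^+ s * (-1) ^+ u) _ _ (IterInt_prod N _ _ (Gv s u)))).
apply: IterInt_ext => l _; rewrite /integrand CmulE Vandermonde_sqr mulr_suml.
apply: eq_bigr => s _; rewrite mulr_suml; apply: eq_bigr => u _.
rewrite CmulE -[RHS]mulrA; congr (_ * _).
rewrite !Cprod_map -big_split; apply: eq_bigr => i _.
by rewrite /G CpowE mE.
Qed.

Lemma prefactor_integral N x t :
  Cmul (prefactor N)
    (two_pi_i ^+ N * Cof (contour_scale N t ^+ N * (N`!%:R * \det (hankel N x t))))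
  = Cof (exp (- (INR N * t)) *
         ((-1) ^+ Nat.div (Nat.mul N (Nat.sub N 1)) 2 * \det (hankel N x t))).
Proof.
rewrite /prefactor -(RpowE (contour_scale N t)) contour_scale_pow -CpowE.
rewrite !CmulE mulrA -[_ * Cinv _ * _]mulrA -!CmulE Cinv_Cpow_two_pi_i.
rewrite !CmulE mulr1 -rmorphM; congr Cof.
rewrite !RdivE RpowE INRE factE.
have fact_neq0 : N`!%:R != 0 :> R by rewrite Num.Theory.pnatr_eq0 -lt0n fact_gt0.
have -> : IZR (-1) = -1 :> R by [].
by field.
Qed.

Lemma exp_growth_entry N k x j i : exp_growth (entry N k x j i).
Proof.
apply: (exp_growth_shift (fun w => _ (Z.sub w (Z.of_nat i)))).
by apply: exp_growth_shift; apply: exp_growth_iter; apply: exp_growth_negbin.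
Qed.

(** Time evolution commutes with differences and translations, so all evolved entries come from a
    single function of position. *)
Lemma egf_entry N k x j i z t : egf (entry N k x j i) z t =
  Nat.iter (N.-1 - i + colexp k j) bdiff (fun z => egf (negbin N.-1) z t)
    (Z.sub (Z.sub z x) (Z.of_nat i)).
Proof.
rewrite -egf_iter_bdiff; last exact: exp_growth_negbin.
rewrite -(egf_shift _ (Z.of_nat i)).
exact: (egf_shift (fun w => _ (Z.sub w (Z.of_nat i)))).
Qed.

(** The factor $e^{-Nt}$ turns the generator series into the Poisson sum. Starting from [Yinit], row
    [j] sits at [j.+1], the form required by [det_bdiff_hankel], which removes [k]. *)
Lemma tasep_prob_hankel N k x t : le 1 k /\ le k N ->
  tasep_prob_is N (Yinit N, nu N k) (Eevent N k x) t
    (exp (- (INR N * t)) *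
      ((-1) ^+ Nat.div (Nat.mul N (Nat.sub N 1)) 2 * \det (hankel N x t))).
Proof.
move=> [/leP k_gt0 /leP lekN]; have kN : (0 < k <= N)%N by rewrite k_gt0.
set Y := fun j => List.nth j (Yinit N) Z0.
have := abs_sum_scal (exp (- (INR N * t))) _ _
  (pdet_series N (entry N k x) Y t (exp_growth_entry N k x)).
have -> : \matrix_(j < N, i < N) egf (entry N k x j i) (Y j) t =
    \matrix_(j < N, i < N) Nat.iter (N.-1 - i + colexp k j) bdiff
      (fun z => egf (negbin N.-1) z t)
      (Z.sub (Z.sub (Z.of_nat j.+1) x) (Z.of_nat i)).
  apply/matrixP => j i; rewrite !mxE egf_entry /Y nth_Yinit //.
  by apply/ltP.
rewrite det_bdiff_hankel; last first.
  by move=> j; rewrite /colexp; case: ifP => // _; apply: leq_pred.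
move/abs_sum_infinite_sum; apply: infinite_sum_ext => n.
rewrite (cnt_eq_iter_gen N k x n _ kN (increasing_Yinit N)).
by rewrite RpowE !INRE factE RdivE !RmultE !mulrA.
Qed.

End TasepProbability.

Theorem theorem1p2 (N k : nat) (x : Z) (t r : R) :
  (1 <= N)%nat -> (1 <= k <= N)%nat -> 0 <= t -> 0 < r < 1 ->
  exists J : Cx,
    IterInt N (integrand N x t r) J /\
    snd (Cmul (prefactor N) J) = 0 /\
    tasep_prob_is N (Yinit N, nu N k) (Eevent N k x) t (fst (Cmul (prefactor N) J)).
Proof.
intros _ Hk Ht Hr.
eexists; split; [apply (TasepProbability.IterInt_integrand N x t r Ht Hr)|].
(* The value is now [Cof] of a real number, so its imaginary part is 0 by computation. *)
rewrite TasepProbability.prefactor_integral; split; [reflexivity|].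
now apply TasepProbability.tasep_prob_hankel.
Qed.
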